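(* Let $a_2^{\pm},a_3^{\pm},b_2^{\pm},b_3^{\pm}\in\mathbb{R}$ and consider the cubic switching Liénard system $$(\dot x,\dot y)=\begin{cases}\big(y-(a_2^+x^2+a_3^+x^3),\ -(b_2^+x^2+b_3^+x^3)\big), & x\ge 0,\\ \big(y-(a_2^-x^2+a_3^-x^3),\ -(b_2^-x^2+b_3^-x^3)\big), & x<0.\end{cases}$$ Assume $b_2^+\geq 0$ and $b_2^-\leq 0$. Then the origin is a nilpotent global center of this system if one of the following conditions holds: ($G_1$) $a_2^{\pm}=a_3^{\pm}=0$, $b_3^+>0$, $b_3^->0$; ($G_2$) $a_2^-=a_2^+$, $a_3^{\pm}=0$, $b_2^-=-b_2^+$, $b_3^-=b_3^+>\tfrac12 (a_2^+)^2$.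
   Context: The line $x=0$ is the switching manifold; the vector field for $x\ge0$ is the first system and the one for $x<0$ is the second system. On $x=0$ both vector fields have $\dot x=y$, so orbits of the switching system cross $x=0$ at every point other than the origin, and orbits are obtained by concatenating orbit arcs of the two systems. A condition written with a superscript $\pm$ means that it holds for both signs. The origin is a nilpotent singular point: it is an isolated singular point at which the Jacobian matrix of each of the two systems has both eigenvalues zero but is not the zero matrix. The origin is a nilpotent center if it is such a nilpotent singular point and it has a neighborhood in which every orbit other than the origin is a periodic orbit surrounding the origin. A center is global if the whole plane, except for the center itself, is filled with periodic orbits. *)

(* Defs.v *)
From HB Require Import structures.
From mathcomp Require Import all_boot all_order all_algebra.
From mathcomp Require Import complex.
From mathcomp Require Import all_classical all_reals all_analysis.

Set Implicit Arguments.
Unset Strict Implicit.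
Unset Printing Implicit Defensive.

Import Order.TTheory GRing.Theory Num.Theory.
Import numFieldNormedType.Exports.

Local Open Scope classical_set_scope.
Local Open Scope ring_scope.

(* A point (x, y) of the plane is a row vector p with x = p 0 0, y = p 0 1.   *)
Notation plane R := 'rV[R]_2.

Section SwitchingSystem.
Context {R : realType}.
Implicit Types (F Fp Fm : plane R -> plane R) (g : R -> plane R).

Definition orbit_arc F (H : set (plane R)) (a b : R) g : Prop :=
  {within `[a, b], continuous g} /\
  forall t, a < t < b -> H (g t) /\ is_derive t 1 g (F (g t)).

(* Fp acts on x >= 0 and Fm on x < 0; the end points of an arc may lie on the *)
(* switching line in both cases.                                              *)
Definition system_arc Fp Fm (a b : R) g : Prop :=
  orbit_arc Fp [set p | 0 <= p 0 0] a b g \/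
  orbit_arc Fm [set p | p 0 0 < 0] a b g.

Definition open_interval (I : set R) : Prop :=
  [/\ open I, is_interval I & I !=set0].

(* Every time t of I ends one arc and starts another one; by compactness this *)
(* says that over each compact subinterval of I the curve is a finite         *)
(* concatenation of arcs.  Only the values of g on I matter.                  *)
Definition solution Fp Fm (I : set R) g : Prop :=
  open_interval I /\
  forall t, I t -> exists2 e, 0 < e &
    system_arc Fp Fm (t - e) t g /\ system_arc Fp Fm t (t + e) g.

Definition maximal_solution Fp Fm (I : set R) g : Prop :=
  solution Fp Fm I g /\
  forall J h, solution Fp Fm J h -> I `<=` J -> {in I, h =1 g} -> J = I.

Definition orbit Fp Fm (O : set (plane R)) : Prop :=
  exists I g, maximal_solution Fp Fm I g /\ O = g @` I.

Definition periodic_orbit Fp Fm (O : set (plane R)) : Prop :=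
  exists g (T : R), [/\ solution Fp Fm setT g, 0 < T,
    forall t, g (t + T) = g t, exists t, g t != g 0 & O = range g].

(* c lies in a bounded component of the complement of O, i.e. inside the      *)
(* closed curve O.                                                            *)
Definition surrounds (O : set (plane R)) (c : plane R) : Prop :=
  ~ O c /\ bounded_set (connected_component (~` O) c).

Definition switching_field Fp Fm (p : plane R) : plane R :=
  if 0 <= p 0 0 then Fp p else Fm p.

Definition isolated_singular_point Fp Fm (c : plane R) : Prop :=
  [/\ Fp c = 0, Fm c = 0 & \forall p \near c^', switching_field Fp Fm p != 0].

(* The eigenvalues are taken in the complex numbers R[i].                     *)
Definition nilpotent_nonzero (A : 'M[R]_2) : Prop :=
  eigenvalue (map_mx (real_complex R) A) =1 pred1 0 /\ A != 0.

Definition nilpotent_singular_point Fp Fm (c : plane R) : Prop :=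
  [/\ isolated_singular_point Fp Fm c,
      nilpotent_nonzero (jacobian Fp c) & nilpotent_nonzero (jacobian Fm c)].

Definition nilpotent_center Fp Fm (c : plane R) : Prop :=
  nilpotent_singular_point Fp Fm c /\
  exists2 U, nbhs c U &
    forall O, orbit Fp Fm O -> O `&` U !=set0 -> O <> [set c] ->
      periodic_orbit Fp Fm O /\ surrounds O c.

Definition nilpotent_global_center Fp Fm (c : plane R) : Prop :=
  nilpotent_center Fp Fm c /\
  \bigcup_(O in periodic_orbit Fp Fm) O = ~` [set c].

Definition lienard (a2 a3 b2 b3 : R) (p : plane R) : plane R :=
  let x := p 0 0 in let y := p 0 1 in
  \row_(i < 2) if i == 0 then y - (a2 * x ^+ 2 + a3 * x ^+ 3)
               else - (b2 * x ^+ 2 + b3 * x ^+ 3).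

End SwitchingSystem.

(* Main.v *)
Require Import Defs.
From HB Require Import structures.
From mathcomp Require Import all_boot all_order all_algebra.
From mathcomp Require Import complex ring lra.
From mathcomp Require Import all_classical all_reals all_analysis.

Set Implicit Arguments.
Unset Strict Implicit.
Unset Printing Implicit Defensive.

Import Order.TTheory GRing.Theory Num.Theory.
Import numFieldNormedType.Exports.

Local Open Scope classical_set_scope.
Local Open Scope ring_scope.

(** On both sides of the switching line the equations are x' = y - a x^2 and
    y' = - psi x with the same a, where a^2 / 2 is smaller than both cubic
    coefficients.  The function psi is locally Lipschitz across x = 0, so the
    solutions of the switching system are those of one ordinary differential
    equation to which the usual existence and uniqueness results apply
    ([global_solution], [lienard_unique], [solution_lienard],
    [lienard_solution]).

    The main point is that an orbit entering the half plane x > 0 leaves it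
    through the negative y axis in finite time ([half_orbit]).  There y decreases,
    and r = y / x^2 - a satisfies r' = - b2 - 2 x (r^2 + a r + b3 / 2), where the
    quadratic polynomial in r is bounded below by k (r^2 + 1) for some k > 0.
    Since (ln x)' = x r, the quantity 4 k ln x + r decreases and 4 k ln x - r
    increases.  The first one bounds x, which excludes blow-up.  By the second
    one r tends to minus infinity unless the orbit leaves; but then y and x'
    become negative and bounded away from 0.  Reflections in x, y and t reduce
    backward orbits and the half plane x < 0 to this case.

    Hence the orbit of (0, y0), y0 > 0, meets the negative y axis both forwards
    and backwards, and it remains to see that it does so at the same point
    ([closed_solution_exists]).  If a = 0, the energy of each half system gives
    y = - y0 at both points.  In the other case psi is odd and the system is
    reversible under (x, t) |-> (- x, - t).  So the orbit is periodic.  Every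
    point other than the origin is joined in the same way to the positive y axis
    and lies on such an orbit ([closed_solution_through]).  Finally y is monotone
    on each half of the orbit, which therefore consists of two graphs over the y
    axis with the origin in between ([closed_solution_surrounds]). *)

(** * Calculus on the real line *)

Section Calculus.
Context {R : realType}.
Implicit Types (f g h df : R -> R) (a b c k t : R) (n : nat).

Lemma is_derive_continuous f t l : is_derive t 1 f l -> {for t, continuous f}.
Proof.
by case=> df _; apply/differentiable_continuous/derivable1_diffP.
Qed.

(** The rules of differentiation, for functions given pointwise. *)
Lemma derive_cstf t c : is_derive t 1 (fun=> c) 0.
Proof. exact: is_derive_cst. Qed.

Lemma derive_idf t : is_derive t 1 (fun s => s) 1.
Proof. exact: is_derive_id. Qed.

Lemma derive_addf f g t a b : is_derive t 1 f a -> is_derive t 1 g b ->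
  is_derive t 1 (fun s => f s + g s) (a + b).
Proof. exact: is_deriveD. Qed.

Lemma derive_oppf f t a : is_derive t 1 f a -> is_derive t 1 (fun s => - f s) (- a).
Proof. exact: is_deriveN. Qed.

Lemma derive_mulf f g t a b : is_derive t 1 f a -> is_derive t 1 g b ->
  is_derive t 1 (fun s => f s * g s) (f t * b + g t * a).
Proof. exact: is_deriveM. Qed.

Lemma derive_expf f n t a : is_derive t 1 f a ->
  is_derive t 1 (fun s => f s ^+ n) (n%:R * f t ^+ n.-1 * a).
Proof.
by move=> fa; have := @is_deriveX R R f n t 1 a fa; rewrite exprfctE.
Qed.

Lemma derive_invf f t a : f t != 0 -> is_derive t 1 f a ->
  is_derive t 1 (fun s => (f s)^-1) (- (f t) ^- 2 * a).
Proof. exact: is_deriveV. Qed.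

Lemma derive_expRf f t a : is_derive t 1 f a ->
  is_derive t 1 (fun s => expR (f s)) (expR (f t) * a).
Proof. by move=> fa; apply: (@is_derive1_comp _ expR f). Qed.

Lemma derive_lnf f t a : 0 < f t -> is_derive t 1 f a ->
  is_derive t 1 (fun s => ln (f s)) ((f t)^-1 * a).
Proof.
move=> f0 fa; apply: (@is_derive1_comp _ (@ln R) f) => //.
exact: is_derive1_ln.
Qed.

Lemma is_derive_within f df a b :
  (forall t, a <= t <= b -> is_derive t 1 f (df t)) ->
  {within `[a, b], continuous f}.
Proof.
move=> fdf; apply: derivable_within_continuous => t.
by rewrite in_itv/= => /fdf [].
Qed.

Lemma mvt_ge f df k a b : a <= b -> {within `[a, b], continuous f} ->
  (forall t, a < t < b -> is_derive t 1 f (df t)) ->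
  (forall t, a < t < b -> k <= df t) -> k * (b - a) <= f b - f a.
Proof.
rewrite le_eqVlt => /predU1P[-> *|ab cf fdf dfk]; first by rewrite !subrr mulr0.
have fdf' x : x \in `]a, b[ -> is_derive x 1 f (df x).
  by rewrite in_itv/=; exact: fdf.
have [c] := MVT ab fdf' cf.
by rewrite in_itv/= => /dfk kc ->; rewrite ler_pM2r// subr_gt0.
Qed.

Lemma mvt_le f df k a b : a <= b -> {within `[a, b], continuous f} ->
  (forall t, a < t < b -> is_derive t 1 f (df t)) ->
  (forall t, a < t < b -> df t <= k) -> f b - f a <= k * (b - a).
Proof.
rewrite le_eqVlt => /predU1P[-> *|ab cf fdf dfk]; first by rewrite !subrr mulr0.
have fdf' x : x \in `]a, b[ -> is_derive x 1 f (df x).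
  by rewrite in_itv/=; exact: fdf.
have [c] := MVT ab fdf' cf.
by rewrite in_itv/= => /dfk kc ->; rewrite ler_pM2r// subr_gt0.
Qed.

Lemma mvt_segment_ge f df k a b : a <= b ->
  (forall t, a <= t <= b -> is_derive t 1 f (df t)) ->
  (forall t, a <= t <= b -> k <= df t) -> k * (b - a) <= f b - f a.
Proof.
move=> ab fdf dfk; apply: (mvt_ge ab (is_derive_within fdf)) => t /andP[at_ tb].
  by apply: fdf; rewrite !ltW.
by apply: dfk; rewrite !ltW.
Qed.

Lemma mvt_segment_le f df k a b : a <= b ->
  (forall t, a <= t <= b -> is_derive t 1 f (df t)) ->
  (forall t, a <= t <= b -> df t <= k) -> f b - f a <= k * (b - a).
Proof.
move=> ab fdf dfk; apply: (mvt_le ab (is_derive_within fdf)) => t /andP[at_ tb].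
  by apply: fdf; rewrite !ltW.
by apply: dfk; rewrite !ltW.
Qed.

Lemma mvt_gt f df k a b : a < b -> {within `[a, b], continuous f} ->
  (forall t, a < t < b -> is_derive t 1 f (df t)) ->
  (forall t, a < t < b -> k < df t) -> k * (b - a) < f b - f a.
Proof.
move=> ab cf fdf dfk.
have fdf' x : x \in `]a, b[ -> is_derive x 1 f (df x).
  by rewrite in_itv/=; exact: fdf.
have [c] := MVT ab fdf' cf.
by rewrite in_itv/= => /dfk kc ->; rewrite ltr_pM2r// subr_gt0.
Qed.

Lemma mvt_lt f df k a b : a < b -> {within `[a, b], continuous f} ->
  (forall t, a < t < b -> is_derive t 1 f (df t)) ->
  (forall t, a < t < b -> df t < k) -> f b - f a < k * (b - a).
Proof.
move=> ab cf fdf dfk.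
have fdf' x : x \in `]a, b[ -> is_derive x 1 f (df x).
  by rewrite in_itv/=; exact: fdf.
have [c] := MVT ab fdf' cf.
by rewrite in_itv/= => /dfk kc ->; rewrite ltr_pM2r// subr_gt0.
Qed.

Lemma is_derive_opp_arg f t l :
  is_derive (- t) 1 f l -> is_derive t 1 (fun s => f (- s)) (- l).
Proof.
move=> fl; have -> : - l = l * (- 1) by rewrite mulrN1.
by apply: (@is_derive1_comp _ f (fun s => - s)).
Qed.

Lemma continuous_opp_arg f : continuous f -> continuous (fun t => f (- t)).
Proof.
by move=> cf t; apply: (@continuous_comp _ _ _ -%R f);
  [exact: oppr_continuous|exact: cf].
Qed.

Lemma is_derive_shift_arg f t c l :
  is_derive (t + c) 1 f l -> is_derive t 1 (fun s => f (s + c)) l.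
Proof.
move=> fl; rewrite -[l]mulr1.
apply: (@is_derive1_comp _ f (fun s => s + c)).
by apply: is_derive_eq; rewrite addr0.
Qed.

(** If the derivative of f on a punctured neighborhood of t extends
    continuously to t, then f is differentiable at t as well. *)
Lemma deriv_limit f df t e : 0 < e ->
  {within `[t - e, t + e], continuous f} ->
  (forall s, 0 < `|s - t| < e -> is_derive s 1 f (df s)) ->
  {for t, continuous df} -> is_derive t 1 f (df t).
Proof.
move=> e0 cf fdf cdf.
have main d : 0 < d -> \forall s \near t, `|f s - f t - df t * (s - t)| <= d * `|s - t|.
  move=> d0; move/cvgrPdist_le : cdf => /(_ _ d0)[/= r r0 rdf].
  exists (Num.min r e) => /=; first by rewrite lt_min r0.
  move=> s /=; rewrite distrC lt_min => /andP[sr se].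
  have cfs u v : t - e <= u -> v <= t + e -> {within `[u, v], continuous f}.
    move=> tu vt; apply: continuous_subspaceW cf.
    by apply: subset_itv; rewrite bnd_simp.
  move: sr se; have [st|ts|<-] := ltgtP s t; last 1 first.
    by rewrite !subrr mulr0 !normr0 subr0 normr0 mulr0.
  - rewrite ltr_distl ltr0_norm ?subr_lt0// => /andP[sr1 sr2] se.
    have H u : s < u < t -> is_derive u 1 f (df u) /\ `|df t - df u| <= d.
      move=> /andP[su ut]; split.
        by apply: fdf; rewrite ltr0_norm ?subr_lt0//; lra.
      by apply: rdf; rewrite /= gtr0_norm ?subr_gt0//; lra.
    have cst := cfs s t ltac:(lra) ltac:(lra).
    have U := @mvt_le f df (df t + d) s t (ltW st) cst (fun u p => (H u p).1).
    have L := @mvt_ge f df (df t - d) s t (ltW st) cst (fun u p => (H u p).1).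
    have {}U := U (fun u p => ltac:(have := (H u p).2; rewrite ler_norml => /andP[]; lra)).
    have {}L := L (fun u p => ltac:(have := (H u p).2; rewrite ler_norml => /andP[]; lra)).
    by rewrite ler_norml; apply/andP; split; nra.
  - rewrite ltr_distl gtr0_norm ?subr_gt0// => /andP[sr1 sr2] se.
    have H u : t < u < s -> is_derive u 1 f (df u) /\ `|df t - df u| <= d.
      move=> /andP[su ut]; split.
        by apply: fdf; rewrite gtr0_norm ?subr_gt0//; lra.
      by apply: rdf; rewrite /= distrC gtr0_norm ?subr_gt0//; lra.
    have cst := cfs t s ltac:(lra) ltac:(lra).
    have U := @mvt_le f df (df t + d) t s (ltW ts) cst (fun u p => (H u p).1).
    have L := @mvt_ge f df (df t - d) t s (ltW ts) cst (fun u p => (H u p).1).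
    have {}U := U (fun u p => ltac:(have := (H u p).2; rewrite ler_norml => /andP[]; lra)).
    have {}L := L (fun u p => ltac:(have := (H u p).2; rewrite ler_norml => /andP[]; lra)).
    by rewrite ler_norml; apply/andP; split; nra.
have cv : h^-1 *: (f (h *: 1 + t) - f t) @[h --> 0^'] --> df t.
  apply/cvgrPdist_le => /= d d0.
  have [/= r r0 rP] := main _ d0.
  exists r => //= h; rewrite /= sub0r normrN => hr h0.
  have /rP : ball t r (h *: 1 + t).
    by rewrite /ball/= opprD addrA addrAC subrr add0r normrN /GRing.scale/= mulr1.
  rewrite addrK /GRing.scale/= mulr1 => H.
  have -> : df t - h^-1 * (f (h + t) - f t) = - h^-1 * (f (h + t) - f t - df t * h).
    by field.
  by rewrite normrM normrN normfV ler_pdivrMl ?normr_gt0 // [`|h| * d]mulrC.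
split; first by apply/cvg_ex; exists (df t).
exact/cvg_lim.
Qed.

Lemma primitive_exists h (v : R) : continuous h ->
  exists H : R -> R, H 0 = v /\ forall t, is_derive t 1 H (h t).
Proof.
move=> ch.
pose mu := @lebesgue_measure R.
have ih a b : mu.-integrable `[a, b] (EFin \o h).
  apply: continuous_compact_integrable; first exact: segment_compact.
  exact: continuous_subspaceT.
pose J a b : R := (\int[mu]_(t in `[a, b]) h t)%R.
have JD a b c : a <= b <= c -> J a c = J a b + J b c.
  move=> /andP[ab bc]; rewrite /J -(@Rintegral_itv_obnd_cbnd R b).
    by rewrite -(@Rintegral_itvB R h (BLeft a) (BRight c) b)// addrC subrK.
  apply: integrableS (ih b c) => //.
  by apply: subset_itv; rewrite bnd_simp.
exists (fun t => v + (if 0 <= t then J 0 t else - J t 0)); split.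
  by rewrite lexx /J set_itv1 Rintegral_set1 addr0.
move=> t.
(* near t, H differs by a constant from the integral from a base point - N to
   the left of 0 and of t *)
pose N := `|t| + 1.
have tN : - N < t < N.
  by rewrite /N; have := ler_norm t; have := ler_norm (-t); rewrite normrN; lra.
have N0 : 0 < N by rewrite /N; have := normr_ge0 t; lra.
have [dJ vJ] := @continuous_FTC1_closed R h (- N) t N ltac:(lra) (ih _ _) ltac:(lra) (ch t).
have dH : is_derive t 1 (fun s => v - J (- N) 0 + J (- N) s) (h t).
  have dJ' : is_derive t 1 (J (- N)) (h t) by split=> //; rewrite -derive1E.
  by apply: is_derive_eq (derive_addf (derive_cstf _ _) dJ') _; rewrite add0r.
apply: near_eq_is_derive dH.
near=> s.
have : s \in `]- N, N[ by near: s; apply: near_in_itvoo; rewrite in_itv.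
rewrite in_itv/= => sN.
have [s0|s0] := leP 0 s.
  by rewrite (JD (- N) 0 s) ?s0 ?(ltW (andP sN).1) ?oppr_le0 ?(ltW N0)//; ring.
have sn0 : - N <= s <= 0 by lra.
by rewrite (JD (- N) s 0 sn0); ring.
Unshelve. all: by end_near. Qed.

End Calculus.

(* Instance resolution is disabled so that derivatives keep the shape given by
   the pointwise rules above. *)
Ltac derive_rules := repeat first
  [ eassumption
  | notypeclasses refine (derive_cstf _ _)
  | notypeclasses refine (derive_idf _)
  | notypeclasses refine (derive_addf _ _)
  | notypeclasses refine (derive_oppf _)
  | notypeclasses refine (derive_mulf _ _)
  | notypeclasses refine (derive_expf _ _)
  | notypeclasses refine (derive_expRf _) ].

Ltac derive_eq := notypeclasses refine (is_derive_eq _ _); [derive_rules|rewrite /=].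

Section RealFunctions.
Context {R : realType}.
Implicit Types (f : R -> R) (a b c t : R).

Lemma ivt_incr f a b v : continuous f -> a <= b -> f a <= v <= f b ->
  exists2 c, a <= c <= b & f c = v.
Proof.
move=> cf ab /andP[av vb]; have fab := le_trans av vb.
have [|c] := IVT ab (continuous_subspaceT cf) (v := v).
  by rewrite minEle maxEle fab av.
by rewrite in_itv/=; exists c.
Qed.

Lemma ivt_decr f a b v : continuous f -> a <= b -> f b <= v <= f a ->
  exists2 c, a <= c <= b & f c = v.
Proof.
move=> cf ab /andP[bv va].
have cNf : continuous (fun s => - f s) by move=> s; apply: cvgN; exact: cf.
have [|c acb fc] := ivt_incr cNf ab (v := - v); first by rewrite !lerN2 va.
by exists c => //; exact: oppr_inj.
Qed.

(** The first time at which f reaches the level c. *)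
Lemma first_hit_up f a b c : continuous f -> a <= b -> f a < c -> c <= f b ->
  exists t, [/\ a < t, t <= b, f t = c & forall s, a <= s < t -> f s < c].
Proof.
move=> cf ab fac cfb.
pose A := `[a, b] `&` f @^-1` [set u | c <= u].
have cA : compact A.
  apply: compact_closedI; first exact: segment_compact.
  by apply: closed_comp; [move=> ? _; exact: cf|exact: closed_ge].
have A0 : A !=set0 by exists b; split => //=; rewrite in_itv/= ab lexx.
have [t] := compact_EVT_min A0 cA (continuous_subspaceT (fun x => @cvg_id R (nbhs x))).
rewrite inE => -[/=]; rewrite in_itv/= => /andP[at_ tb] cft tmin.
have bef s : a <= s < t -> f s < c.
  move=> /andP[as_ st]; rewrite ltNge; apply/negP => cfs.
  have sA : s \in A.
    by rewrite inE; split => //=; rewrite in_itv/= as_ ltW// (lt_le_trans st).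
  by have := tmin s sA; rewrite leNgt st.
have lt_at : a < t.
  by rewrite lt_neqAle at_ andbT; apply: contraTneq fac => ->; rewrite -leNgt.
have [|u /andP[au ut] fuc] := ivt_incr cf at_ (v := c); first by rewrite (ltW fac).
have tu : t = u.
  apply/eqP; rewrite eq_le ut andbT leNgt; apply/negP => ut'.
  by have := bef u; rewrite au ut' fuc ltxx => /(_ isT).
by exists t; split => //; rewrite tu.
Qed.

Lemma first_hit_down f a b c : continuous f -> a <= b -> c < f a -> f b <= c ->
  exists t, [/\ a < t, t <= b, f t = c & forall s, a <= s < t -> c < f s].
Proof.
move=> cf ab fac cfb.
have [|||t [at_ tb ftc bef]] := @first_hit_up (fun s => - f s) a b (- c) _ ab.
- by move=> s; apply: cvgN; exact: cf.
- by rewrite ltrN2.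
- by rewrite lerN2.
exists t; split => //; first exact: oppr_inj.
by move=> s /bef; rewrite ltrN2.
Qed.

Lemma derive_pos_local f t l : is_derive t 1 f l -> 0 < l ->
  exists2 e, 0 < e & forall h, 0 < h < e -> f (t - h) < f t < f (t + h).
Proof.
move=> [df <-] l0; move: df => /cvgrPdist_lt/(_ _ l0)[/= e e0 eP].
have quot h : `|h| < e -> h != 0 -> 0 < h^-1 * (f (h + t) - f t).
  move=> he h0; have := eP h; rewrite /= sub0r normrN => /(_ he h0).
  by rewrite /GRing.scale/= mulr1 ltr_norml => /andP[_]; rewrite /derive; lra.
exists e => // h /andP[h0 he]; apply/andP; split.
  have := quot (- h); rewrite normrN gtr0_norm// oppr_eq0 gt_eqF// => /(_ he isT).
  by rewrite invrN mulNr -mulrN pmulr_rgt0 ?invr_gt0// (addrC t); lra.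
have := quot h; rewrite gtr0_norm// gt_eqF// => /(_ he isT).
by rewrite pmulr_rgt0 ?invr_gt0// (addrC t); lra.
Qed.

End RealFunctions.

(** * Existence and uniqueness for Lipschitz systems *)

Section GlobalSolutions.
Context {R : realType} {I : finType}.

Lemma geometric_limit (u : nat -> R) (K : R) :
  (forall n, `|u n.+1 - u n| <= K / 2 ^+ n) ->
  exists l, forall n, `|u n - l| <= 2 * K / 2 ^+ n.
Proof.
move=> uK.
have K0 : 0 <= K by have := uK 0%N; rewrite expr0 divr1; apply: le_trans.
(* the intervals [u n - e n, u n + e n] are nested *)
pose e n := 2 * K / 2 ^+ n.
have eS n : e n.+1 = e n - K / 2 ^+ n.
  by rewrite /e exprS; field; rewrite expf_neq0.
have e0 n : 0 <= e n by rewrite /e divr_ge0// ?mulr_ge0// exprn_ge0.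
have step n m : u n - e n <= u (n + m)%N - e (n + m)%N /\
                u (n + m)%N + e (n + m)%N <= u n + e n.
  elim: m => [|m [IH1 IH2]]; first by rewrite addn0.
  have := uK (n + m)%N; rewrite ler_norml addnS eS => /andP[]; lra.
have le_ab m n : u m - e m <= u n + e n.
  have [mn|/ltnW nm] := leqP m n.
    by have := step m (n - m)%N; rewrite subnKC// => -[]; have := e0 n; lra.
  by have := step n (m - n)%N; rewrite subnKC// => -[]; have := e0 m; lra.
pose A := range (fun n => u n - e n).
have A0 : A !=set0 by exists (u 0%N - e 0%N); exists 0%N.
have ubA n : ubound A (u n + e n) by move=> _ [m _ <-].
exists (sup A) => n.
have h1 : sup A <= u n + e n by exact: ge_sup.
have h2 : u n - e n <= sup A.
  apply: ub_le_sup; first by exists (u 0%N + e 0%N).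
  by exists n.
by rewrite -/(e n) ler_norml; apply/andP; split; lra.
Qed.

Variables (F : I -> (I -> R) -> R) (L : R).
Hypothesis L_gt0 : 0 < L.
Hypothesis F_lip : forall i (u v : I -> R) (d : R),
  (forall j, `|u j - v j| <= d) -> `|F i u - F i v| <= L * d.

Let L_neq0 : L != 0. Proof. exact: lt0r_neq0. Qed.

(* The weight that makes the integral operator a contraction. *)
Let w (t : R) : R := expR (2 * L * t) + expR (- (2 * L * t)).

Let w_ge0 t : 0 <= w t. Proof. by rewrite addr_ge0 ?expR_ge0. Qed.

Let w_ge1 t : 1 <= w t.
Proof.
rewrite /w; have [t0|t0] := leP 0 (2 * L * t).
  by have := expR_ge1Dx (2 * L * t); have := expR_ge0 (- (2 * L * t)); lra.
have := expR_ge1Dx (- (2 * L * t)); have := expR_ge0 (2 * L * t); lra.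
Qed.

Let w_primitive (t : R) : is_derive t 1
  (fun s : R => (expR (2 * L * s) - expR (- (2 * L * s))) / (2 * L)) (w t).
Proof.
derive_eq.
by rewrite /w; field.
Qed.

(* Integration from 0 divides the norm weighted by w by 2 L. *)
Let primitive_bound (H h : R -> R) (K : R) : (forall t : R, is_derive t 1 H (h t)) ->
  H 0 = 0 -> (forall t, `|h t| <= K * w t) ->
  forall t, `|H t| <= K / (2 * L) * w t.
Proof.
move=> Hh H0 hK t.
have K0 : 0 <= K.
  by have := hK 0; have := normr_ge0 (h 0); have := w_ge1 0; nra.
pose W s : R := K * ((expR (2 * L * s) - expR (- (2 * L * s))) / (2 * L)).
have W0 : W 0 = 0 by rewrite /W mulr0 oppr0 subrr mul0r mulr0.
have dW (s : R) : is_derive s 1 W (K * w s).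
  have dw := w_primitive s; derive_eq.
  by rewrite mulr0 addr0.
have dm (s : R) : is_derive s 1 (fun s : R => W s - H s) (K * w s - h s) by derive_rules.
have dp (s : R) : is_derive s 1 (fun s : R => W s + H s) (K * w s + h s) by derive_rules.
have L2 : 0 < 2 * L by rewrite mulr_gt0.
have Ww : `|W t| <= K / (2 * L) * w t.
  have e1 := expR_ge0 (2 * L * t); have e2 := expR_ge0 (- (2 * L * t)).
  have -> : W t = K / (2 * L) * (expR (2 * L * t) - expR (- (2 * L * t))).
    by rewrite /W; field.
  have Kl : 0 <= K / (2 * L) by rewrite divr_ge0// ltW.
  by rewrite normrM (ger0_norm Kl) ler_wpM2l// /w ler_norml; lra.
apply: le_trans Ww.
have [t0|/ltW t0] := leP 0 t.
  have A := mvt_ge t0 (is_derive_within (fun s _ => dm s)) (fun s _ => dm s)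
    (k := 0) (fun s _ => ltac:(by have := hK s; rewrite ler_norml => /andP[]; lra)).
  have B := mvt_ge t0 (is_derive_within (fun s _ => dp s)) (fun s _ => dp s)
    (k := 0) (fun s _ => ltac:(by have := hK s; rewrite ler_norml => /andP[]; lra)).
  move: A B; rewrite /= W0 H0 mul0r => A B.
  by apply: le_trans (ler_norm _); rewrite ler_norml; apply/andP; split; lra.
have A := mvt_ge t0 (is_derive_within (fun s _ => dm s)) (fun s _ => dm s)
    (k := 0) (fun s _ => ltac:(by have := hK s; rewrite ler_norml => /andP[]; lra)).
have B := mvt_ge t0 (is_derive_within (fun s _ => dp s)) (fun s _ => dp s)
    (k := 0) (fun s _ => ltac:(by have := hK s; rewrite ler_norml => /andP[]; lra)).
move: A B; rewrite /= W0 H0 mul0r => A B.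
by rewrite -[leRHS]normrN; apply: le_trans (ler_norm _); rewrite ler_norml; apply/andP; split; lra.
Qed.

Let F_continuous (z : I -> R -> R) i : (forall j, continuous (z j)) ->
  continuous (fun t => F i (z ^~ t)).
Proof.
move=> cz t; apply/cvgrPdist_le => e e0.
have near_z : \forall s \near t, forall j, `|z j t - z j s| <= e / L.
  apply: (@filter_forall R I _ _ (nbhs_filter (t : R))) => j.
  by have /cvgrPdist_le := cz j t; apply; rewrite divr_gt0.
near=> s.
have -> : e = L * (e / L) by field.
by apply: F_lip; near: s.
Unshelve. all: by end_near. Qed.

Let prim_sig (h : R -> R) (v : R) : {H : R -> R |
  continuous h -> H 0 = v /\ forall t : R, is_derive t 1 H (h t)}.
Proof.
apply: cid; have [ch|nch] := pselect (continuous h); last by exists h.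
by have [H HP] := primitive_exists v ch; exists H.
Qed.

Let prim h v := sval (prim_sig h v).

(** Picard's theorem for an autonomous system whose right-hand side is
    Lipschitz, for the sup norm, on the whole space: the initial value problem
    has a solution defined at all times.  The Picard iterates converge
    geometrically, uniformly with respect to the weight w. *)
Theorem global_solution (z0 : I -> R) : exists z : I -> R -> R,
  (forall i, z i 0 = z0 i) /\
  (forall i (t : R), is_derive t 1 (z i) (F i (z ^~ t))).
Proof.
pose zn := fix zn n : I -> R -> R :=
  if n is m.+1 then fun i => prim (fun t => F i (zn m ^~ t)) (z0 i)
  else fun i _ => z0 i.
have czn n : forall i, continuous (zn n i).
  elim: n => [i|n IH i] t; first exact: cst_continuous.
  have [_ d] := svalP (prim_sig (fun t => F i (zn n ^~ t)) (z0 i))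
                  (F_continuous (i := i) IH).
  exact: is_derive_continuous (d t).
have znS n i : zn n.+1 i 0 = z0 i /\
    forall t : R, is_derive t 1 (zn n.+1 i) (F i (zn n ^~ t)).
  by apply: (svalP (prim_sig _ _)); apply: F_continuous.
have zn0 n i : zn n i 0 = z0 i by case: n => [//|n]; have [] := znS n i.
have [K [K0 KP]] : exists K, 0 <= K /\ forall i, `|F i z0| <= K.
  exists (\sum_i `|F i z0|); split; first exact: sumr_ge0.
  by move=> i; rewrite (bigD1 i)//= lerDl sumr_ge0.
pose C := K / (2 * L).
have dzn n i t : `|zn n.+1 i t - zn n i t| <= C * w t / 2 ^+ n.
  elim: n i t => [|n IH] i t.
    rewrite expr0 divr1.
    apply: (primitive_bound (H := fun t => zn 1%N i t - zn 0%N i t)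
      (h := fun=> F i z0 - 0)) => [s||s].
    - notypeclasses refine (derive_addf _ _); first by have [_] := znS 0%N i; apply.
      by notypeclasses refine (derive_oppf _); exact: derive_cstf.
    - by rewrite !zn0 subrr.
    - by rewrite subr0 (le_trans (KP i))// ler_peMr.
  have -> : C * w t / 2 ^+ n.+1 = (L * (C / 2 ^+ n)) / (2 * L) * w t.
    by rewrite exprS; field; rewrite L_neq0 expf_neq0.
  apply: (primitive_bound (H := fun t => zn n.+2 i t - zn n.+1 i t)
      (h := fun t => F i (zn n.+1 ^~ t) - F i (zn n ^~ t))) => [s||s].
  - notypeclasses refine (derive_addf _ _); first by have [_] := znS n.+1 i; apply.
    by notypeclasses refine (derive_oppf _); have [_] := znS n i; apply.
  - by rewrite !zn0 subrr.
  - rewrite -mulrA; apply: F_lip => j.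
    by rewrite mulrAC; exact: IH.
have /choice[zc zcP] : forall it : I * R, exists l,
    forall n, `|zn n it.1 it.2 - l| <= 2 * (C * w it.2) / 2 ^+ n.
  by move=> [i t]; apply: geometric_limit => n; exact: dzn.
pose z i t := zc (i, t).
have zP i t n : `|zn n i t - z i t| <= 2 * (C * w t) / 2 ^+ n.
  exact: (zcP (i, t)).
have C0 : 0 <= C by rewrite divr_ge0// mulr_ge0// ltW.
have small (B e : R) : 0 < e -> exists n, B / 2 ^+ n <= e.
  move=> e0.
  have [n Bn] : exists n, B / e <= n%:R.
    by exists (Num.truncn (B / e)).+1; rewrite ltW// truncnS_gt.
  exists n; rewrite ler_pdivrMr ?exprn_gt0//.
  move: Bn; rewrite ler_pdivrMr// mulrC => /le_trans; apply.
  by rewrite ler_pM2l// -natrX ler_nat ltnW// ltn_expl.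
have cw t : {for t, continuous w}.
  rewrite /w; apply: (@is_derive_continuous _ _ _ _); derive_rules.
have cz i : continuous (z i).
  move=> t; apply/cvgrPdist_le => e e0.
  have [n ne] := small (2 * (C * (w t + 1))) (e / 3) ltac:(lra).
  near=> s.
  have ws : w s <= w t + 1.
    have : `|w t - w s| <= 1.
      by near: s; have /cvgrPdist_le := cw t; apply.
    by rewrite ler_norml => /andP[]; lra.
  have zs : `|zn n i t - zn n i s| <= e / 3.
    by near: s; have /cvgrPdist_le := czn n i t; apply; lra.
  have bd r : w r <= w t + 1 -> `|zn n i r - z i r| <= e / 3.
    move=> wr; apply: le_trans (zP i r n) _; apply: (le_trans _ ne).
    rewrite ler_pM2r ?invr_gt0 ?exprn_gt0// ler_pM2l// ler_wpM2l//.
  have := bd t ltac:(lra); have := bd s ws; move: zs.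
  by rewrite !ler_norml => /andP[? ?] /andP[? ?] /andP[? ?]; apply/andP; split; lra.
exists z; split.
  move=> i; apply/eqP; rewrite eq_sym -subr_eq0 -normr_eq0 eq_le normr_ge0 andbT.
  apply/ler_addgt0Pl => e e0; rewrite addr0.
  have [n ne] := small (2 * (C * w 0)) e e0.
  by have := zP i 0 n; rewrite zn0 => /le_trans; apply.
move=> i t.
have [Z0 dZ] := svalP (prim_sig (fun t => F i (z ^~ t)) (z0 i))
                  (F_continuous (i := i) cz).
set Z := sval _ in Z0 dZ.
suff -> : z i = Z by exact: dZ.
apply/funext => s; apply/eqP; rewrite -subr_eq0 -normr_eq0 eq_le normr_ge0 andbT.
apply/ler_addgt0Pl => e e0; rewrite addr0.
have [n ne] := small (2 * (C * w s)) (e / 2) ltac:(lra).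
have b1 := le_trans (zP i s n) ne.
have b2 : `|zn n.+1 i s - z i s| <= e / 2.
  apply: le_trans (zP i s n.+1) _; apply: (le_trans _ ne).
  have -> : 2 * (C * w s) / 2 ^+ n.+1 = C * w s / 2 ^+ n.
    by rewrite exprS; field; rewrite expf_neq0.
  rewrite ler_pM2r ?invr_gt0 ?exprn_gt0//.
  by have := mulr_ge0 C0 (w_ge0 s); lra.
have b3 : `|Z s - zn n.+1 i s| <= e / 2.
  apply: (@le_trans _ _ (L * (2 * C / 2 ^+ n) / (2 * L) * w s)).
    apply: (primitive_bound (H := fun t => Z t - zn n.+1 i t)
      (h := fun t => F i (z ^~ t) - F i (zn n ^~ t))) => [r||r].
    - notypeclasses refine (derive_addf _ _); first exact: dZ.
      by notypeclasses refine (derive_oppf _); have [_] := znS n i; apply.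
    - by rewrite Z0 zn0 subrr.
    - rewrite -mulrA; apply: F_lip => j; rewrite distrC.
      by have := zP j r n; congr (_ <= _); ring.
  apply: (le_trans _ ne).
  have -> : L * (2 * C / 2 ^+ n) / (2 * L) * w s = (C * w s) / 2 ^+ n.
    by field; rewrite L_neq0 expf_neq0.
  rewrite ler_pM2r ?invr_gt0 ?exprn_gt0//.
  by have := mulr_ge0 C0 (w_ge0 s); lra.
by move: b2 b3; rewrite !ler_norml => /andP[? ?] /andP[? ?]; apply/andP; split; lra.
Unshelve. all: by end_near. Qed.

End GlobalSolutions.

Section Uniqueness.
Context {R : realType}.

(** Gronwall's lemma: d * expR (- K t) decreases and d * expR (K t) increases. *)
Lemma gronwall_eq0 (d d' : R -> R) (K a b c : R) : a <= c <= b ->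
  (forall t : R, a <= t <= b -> is_derive t 1 d (d' t)) ->
  (forall t : R, a <= t <= b -> 0 <= d t /\ `|d' t| <= K * d t) ->
  d c = 0 -> forall t : R, a <= t <= b -> d t = 0.
Proof.
move=> /andP[ac cb] dd' dK dc t /andP[at_ tb].
have [d0 _] := dK t ltac:(by rewrite at_).
suff : d t <= 0 by move=> ?; apply/eqP; rewrite eq_le d0 andbT.
have [ct|/ltW tc] := leP c t.
- have H (s : R) : c <= s <= t -> is_derive s 1 (fun s : R => d s * expR (- K * s))
      (expR (- K * s) * (d' s - K * d s)).
    move=> /andP[cs st]; have ds := dd' s ltac:(lra); derive_eq.
    by ring.
  have := @mvt_le _ _ _ 0 _ _ ct (is_derive_within H)
    (fun s st => H s ltac:(lra)).
  rewrite dc !mul0r subr0 => E.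
  rewrite -(pmulr_lle0 _ (expR_gt0 (- K * t))); apply: E => s st.
  rewrite pmulr_rle0 ?expR_gt0//.
  by have [_] := dK s ltac:(lra); rewrite ler_norml => /andP[]; lra.
- have H (s : R) : t <= s <= c -> is_derive s 1 (fun s : R => d s * expR (K * s))
      (expR (K * s) * (d' s + K * d s)).
    move=> /andP[ts sc]; have ds := dd' s ltac:(lra); derive_eq.
    by ring.
  have := @mvt_ge _ _ _ 0 _ _ tc (is_derive_within H)
    (fun s st => H s ltac:(lra)).
  rewrite dc !mul0r sub0r oppr_ge0 => E.
  rewrite -(pmulr_lle0 _ (expR_gt0 (K * t))); apply: E => s st.
  rewrite pmulr_rge0 ?expR_gt0//.
  by have [_] := dK s ltac:(lra); rewrite ler_norml => /andP[]; lra.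
Qed.

(** Uniqueness for x' = y - phi x, y' = - psi x.  The Lipschitz condition is
    required only between the two solutions. *)
Lemma planar_unique (phi psi x1 y1 x2 y2 : R -> R) (L a b c : R) :
  0 <= L -> a <= c <= b -> x1 c = x2 c -> y1 c = y2 c ->
  (forall t : R, a <= t <= b ->
    is_derive t 1 x1 (y1 t - phi (x1 t)) /\ is_derive t 1 y1 (- psi (x1 t))) ->
  (forall t : R, a <= t <= b ->
    is_derive t 1 x2 (y2 t - phi (x2 t)) /\ is_derive t 1 y2 (- psi (x2 t))) ->
  (forall t : R, a <= t <= b ->
    `|phi (x1 t) - phi (x2 t)| <= L * `|x1 t - x2 t| /\
    `|psi (x1 t) - psi (x2 t)| <= L * `|x1 t - x2 t|) ->
  forall t : R, a <= t <= b -> x1 t = x2 t /\ y1 t = y2 t.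
Proof.
move=> Lge0 acb xc yc d1 d2 lip.
pose d t := (x1 t - x2 t) ^+ 2 + (y1 t - y2 t) ^+ 2.
pose d' t := 2 * (x1 t - x2 t) * ((y1 t - phi (x1 t)) - (y2 t - phi (x2 t))) +
  2 * (y1 t - y2 t) * (- psi (x1 t) + psi (x2 t)).
have dd (t : R) : a <= t <= b -> is_derive t 1 d (d' t).
  move=> tab; have [dx1 dy1] := d1 t tab; have [dx2 dy2] := d2 t tab.
  rewrite /d; derive_eq; rewrite /d' /=; ring.
have dK (t : R) : a <= t <= b -> 0 <= d t /\ `|d' t| <= (1 + 3 * L) * d t.
  move=> tab; split; first by rewrite addr_ge0// sqr_ge0.
  have [] := lip t tab; rewrite /d /d'.
  set u := x1 t - x2 t; set v := y1 t - y2 t.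
  set p := phi (x1 t); set p2 := phi (x2 t).
  set s := psi (x1 t); set s2 := psi (x2 t) => pL sL.
  have -> : 2 * u * (y1 t - p - (y2 t - p2)) + 2 * v * (- s + s2) =
    2 * (u * v) + - (2 * (u * (p - p2))) + - (2 * (v * (s - s2))) by rewrite /v; ring.
  apply: le_trans (ler_normD _ _) _; rewrite normrN.
  apply: le_trans (lerD (ler_normD _ _) (lexx _)) _; rewrite normrN.
  rewrite !normrM !(ger0_norm (ler0n R 2)).
  have uu : u ^+ 2 = `|u| ^+ 2 by rewrite real_normK// num_real.
  have vv : v ^+ 2 = `|v| ^+ 2 by rewrite real_normK// num_real.
  rewrite uu vv.
  have u0 := normr_ge0 u; have v0 := normr_ge0 v.
  have h1 : `|u| * `|p - p2| <= `|u| * (L * `|u|) by rewrite ler_wpM2l.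
  have h2 : `|v| * `|s - s2| <= `|v| * (L * `|u|) by rewrite ler_wpM2l.
  have h3 : 2 * (`|u| * `|v|) <= `|u| ^+ 2 + `|v| ^+ 2.
    by have := sqr_ge0 (`|u| - `|v|); lra.
  have h4 : L * (2 * (`|u| * `|v|)) <= L * (`|u| ^+ 2 + `|v| ^+ 2).
    by rewrite ler_wpM2l.
  have h5 : 0 <= L * `|v| ^+ 2 by rewrite mulr_ge0// sqr_ge0.
  have h6 : 0 <= L * `|u| ^+ 2 by rewrite mulr_ge0// sqr_ge0.
  lra.
have dc : d c = 0 by rewrite /d xc yc !subrr expr0n addr0.
move=> t tab; have := gronwall_eq0 acb dd dK dc tab.
move/eqP; rewrite /d paddr_eq0 ?sqr_ge0// !sqrf_eq0 !subr_eq0.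
by move=> /andP[/eqP-> /eqP->].
Qed.

End Uniqueness.

(** * The half plane x >= 0 *)

Section HalfPlane.
Context {R : realType}.
Variables (a b2 b3 : R).
Hypotheses (b2_ge0 : 0 <= b2) (ab3 : a ^+ 2 / 2 < b3).

(** The curve (x, y) obeys at time t the quadratic-cubic Lienard system that
    defines the motion on one side of the switching line, brought to the half
    plane x >= 0 when the side is x < 0. *)
Definition half_field_at (x y : R -> R) (t : R) : Prop :=
  is_derive t 1 x (y t - a * x t ^+ 2) /\
  is_derive t 1 y (- (b2 * x t ^+ 2 + b3 * x t ^+ 3)).

(** A parabola y = u x^2 is invariant (for b2 = 0) when
    u^2 - a u + b3 / 2 = 0, and r = u - a.  The condition a^2 / 2 < b3 says that
    there is none. *)
Lemma quadratic_coercive : exists2 k, 0 < k &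
  forall r, k * (r ^+ 2 + 1) <= r ^+ 2 + a * r + b3 / 2.
Proof.
pose m := b3 / 2 - a ^+ 2 / 4.
have m0 : 0 < m by have := ab3; rewrite /m; lra.
have a2 := sqr_ge0 a.
pose k := Num.min (1 / 2) (m / (a ^+ 2 / 2 + 1)).
have d0 : 0 < a ^+ 2 / 2 + 1 by lra.
have k0 : 0 < k by rewrite lt_min; apply/andP; split; [lra|exact: divr_gt0].
have k1 : k <= 1 / 2 by rewrite ge_min lexx.
have k2 : k * (a ^+ 2 / 2 + 1) <= m by rewrite -ler_pdivlMr// ge_min lexx orbT.
exists k => // r; have s0 := sqr_ge0 (r + a / 2); have s1 := sqr_ge0 (r + a).
have h1 : r ^+ 2 + 1 <= 2 * (r + a / 2) ^+ 2 + (a ^+ 2 / 2 + 1) by nra.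
have h2 : k * (r ^+ 2 + 1) <= k * (2 * (r + a / 2) ^+ 2 + (a ^+ 2 / 2 + 1)).
  by rewrite ler_pM2l.
have h3 : k * (r + a / 2) ^+ 2 <= 1 / 2 * (r + a / 2) ^+ 2 by rewrite ler_wpM2r.
apply: le_trans h2 _; rewrite /m in k2; nra.
Qed.

Variables (x y : R -> R).
(* As long as x > 0, the ratio r obeys
   r' = - b2 - 2 x (r^2 + a r + b3 / 2), while (ln x)' = x r. *)
Let r t := y t / x t ^+ 2 - a.

Section Monotone.
Variable k : R.
Hypothesis k_gt0 : 0 < k.
Hypothesis k_coercive :
  forall r, k * (r ^+ 2 + 1) <= r ^+ 2 + a * r + b3 / 2.
Variables (s t : R).
Hypothesis st : s <= t.
Hypothesis ode : forall u, s <= u <= t -> 0 < x u /\ half_field_at x y u.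

Let r_derive (u : R) : s <= u <= t -> is_derive u 1 r
  (- b2 - 2 * x u * (r u ^+ 2 + a * r u + b3 / 2)).
Proof.
move=> /ode[x0 [dx dy]]; have x0' := lt0r_neq0 x0.
have dx2 : is_derive u 1 (fun u => x u ^+ 2) (2 * x u * (y u - a * x u ^+ 2)).
  by derive_eq; ring.
have dV : is_derive u 1 (fun u => (x u ^+ 2)^-1)
    (- (x u ^+ 2) ^- 2 * (2 * x u * (y u - a * x u ^+ 2))).
  by apply: derive_invf dx2; rewrite expf_neq0.
rewrite /r; derive_eq; field.
by rewrite x0'.
Qed.

Let ln_derive (u : R) : s <= u <= t -> is_derive u 1 (fun u => ln (x u)) (x u * r u).
Proof.
move=> /ode[x0 [dx dy]]; have x0' := lt0r_neq0 x0.
have dl := derive_lnf x0 dx; derive_eq.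
by rewrite /r; field.
Qed.

Let r_decr_rate (u : R) : s <= u <= t ->
  - b2 - 2 * x u * (r u ^+ 2 + a * r u + b3 / 2) <= - (2 * k * x u) /\
  - b2 - 2 * x u * (r u ^+ 2 + a * r u + b3 / 2) <= - (4 * k * x u * `|r u|).
Proof.
move=> /ode[x0 _]; have b20 := b2_ge0; have kp := k_gt0.
have h1 := k_coercive (r u).
have h2 : 2 * x u * (k * (r u ^+ 2 + 1)) <= 2 * x u * (r u ^+ 2 + a * r u + b3 / 2).
  by rewrite ler_pM2l// mulr_gt0.
have kx : 0 < k * x u by rewrite mulr_gt0.
have h3 : 0 <= k * x u * r u ^+ 2 by rewrite mulr_ge0 ?sqr_ge0// ltW.
(* r^2 + 1 >= 2 |r| *)
have h4 : 0 <= k * x u * (`|r u| - 1) ^+ 2 by rewrite mulr_ge0 ?sqr_ge0// ltW.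
have h5 : `|r u| ^+ 2 = r u ^+ 2 by rewrite real_normK// num_real.
by split; [lra|rewrite sqrrB h5 in h4; lra].
Qed.

Lemma ratio_decr X : (forall u, s <= u <= t -> X <= x u) ->
  r t <= r s - 2 * k * X * (t - s).
Proof.
move=> Xx.
have H u : s <= u <= t ->
    - b2 - 2 * x u * (r u ^+ 2 + a * r u + b3 / 2) <= - (2 * k * X).
  move=> ut; have [+ _] := r_decr_rate ut; move=> /le_trans; apply.
  by rewrite lerN2 ler_pM2l ?mulr_gt0//; apply: Xx.
have := mvt_segment_le st r_derive H.
by lra.
Qed.

(** The next two lemmas bound x from above, resp. from below, in terms of r. *)
Lemma ln_plus_ratio_decr :
  4 * k * ln (x t) + r t <= 4 * k * ln (x s) + r s.
Proof.
pose D u := 4 * k * (x u * r u) + (- b2 - 2 * x u * (r u ^+ 2 + a * r u + b3 / 2)).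
have dD (u : R) : s <= u <= t ->
    is_derive u 1 (fun u : R => 4 * k * ln (x u) + r u) (D u).
  move=> ut; have dl := ln_derive ut; have dr := r_derive ut.
  by derive_eq; rewrite /D; ring.
suff H u : s <= u <= t -> D u <= 0 by have := mvt_segment_le st dD H; lra.
move=> ut'.
have [_] := r_decr_rate ut'; have [x0 _] := ode ut'; rewrite /D.
have : 4 * k * x u * r u <= 4 * k * x u * `|r u|.
  by rewrite ler_pM2l ?ler_norm// !mulr_gt0.
by lra.
Qed.

Lemma ln_minus_ratio_incr :
  4 * k * ln (x s) - r s <= 4 * k * ln (x t) - r t.
Proof.
pose D u := 4 * k * (x u * r u) - (- b2 - 2 * x u * (r u ^+ 2 + a * r u + b3 / 2)).
have dD (u : R) : s <= u <= t ->
    is_derive u 1 (fun u : R => 4 * k * ln (x u) - r u) (D u).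
  move=> ut; have dl := ln_derive ut; have dr := r_derive ut.
  by derive_eq; rewrite /D; ring.
suff H u : s <= u <= t -> 0 <= D u by have := mvt_segment_ge st dD H; lra.
move=> ut'.
have [_] := r_decr_rate ut'; have [x0 _] := ode ut'; rewrite /D.
have : 4 * k * x u * (- r u) <= 4 * k * x u * `|r u|.
  by rewrite ler_pM2l ?ler_normr ?lexx ?orbT// !mulr_gt0.
by lra.
Qed.

End Monotone.
End HalfPlane.

Section HalfOrbit.
Context {R : realType}.
Variables (a b2 b3 : R).
Hypotheses (b2_ge0 : 0 <= b2) (ab3 : a ^+ 2 / 2 < b3).

Let b3_gt0 : 0 < b3.
Proof. by apply: le_lt_trans ab3; rewrite divr_ge0// sqr_ge0. Qed.

Let force_ge0 (u : R) : 0 <= u -> 0 <= b2 * u ^+ 2 + b3 * u ^+ 3.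
Proof.
by move=> u0; rewrite addr_ge0// mulr_ge0 ?exprn_ge0// ltW.
Qed.

Lemma ordinate_nonincr (x y : R -> R) (s t : R) : s <= t ->
  (forall u, s <= u <= t -> 0 <= x u /\ half_field_at a b2 b3 x y u) -> y t <= y s.
Proof.
move=> st ode.
have d (u : R) : s <= u <= t -> is_derive u 1 y (- (b2 * x u ^+ 2 + b3 * x u ^+ 3)).
  by move=> /ode[_ []].
have := mvt_segment_le st d (k := 0); rewrite mul0r subr_le0; apply=> u /ode[xu _].
by rewrite oppr_le0 force_ge0.
Qed.

Section Bound.
Variables (k x0 y0 : R).
Hypothesis k_gt0 : 0 < k.
Hypothesis k_coercive :
  forall r, k * (r ^+ 2 + 1) <= r ^+ 2 + a * r + b3 / 2.

(* The abscissa x1 is positive even if the orbit starts on the switching line,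
   and the ratio is at most |y0| + |a| when x = x1. *)
Let x1 := Num.max x0 1.
Let M0 := x1 * expR ((`|y0| + `|a| + 1) / (4 * k)).

Variables (x y : R -> R).
Hypothesis x_cont : continuous x.
Hypotheses (x_0 : x 0 = x0) (y_0 : y 0 = y0) (x0_ge0 : 0 <= x0).
Hypothesis ode : forall t, 0 <= t -> 0 <= x t <= M0 + 1 -> half_field_at a b2 b3 x y t.

Let x1_ge1 : 1 <= x1. Proof. by rewrite le_max lexx orbT. Qed.
Let x0_le_x1 : x0 <= x1. Proof. by rewrite le_max lexx. Qed.
Let x1_lt_M0 : x1 < M0.
Proof.
rewrite /M0 ltr_pMr ?(lt_le_trans ltr01 x1_ge1)//.
by rewrite expR_gt1 divr_gt0 ?mulr_gt0 ?ltr_wpDl// addr_ge0.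
Qed.

(** The orbit stays at x < M0 + 1 during its stay in the half plane x > 0: where
    x = M0, the bound on ln x + r makes r negative, and r decreases, so that x
    can no longer increase. *)
Lemma right_excursion_bound t : 0 <= t ->
  (forall u, 0 < u <= t -> 0 < x u) -> x t < M0 + 1.
Proof.
move=> t0 xpos; rewrite ltNge; apply/negP => Mx.
have x1g := x1_ge1; have x01 := x0_le_x1; have x1M := x1_lt_M0.
have xM : x 0 < M0 + 1 by rewrite x_0; lra.
have [t1 [t1_0 t1_t xt1 bef]] := first_hit_up x_cont t0 xM Mx.
have odeon u : 0 <= u <= t1 -> half_field_at a b2 b3 x y u.
  move=> /andP[u0 ut]; apply: ode => //; apply/andP; split.
    have [<-|un0] := eqVneq 0 u; first by rewrite x_0.
    have up : 0 < u by rewrite lt_neqAle un0.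
    by apply/ltW/xpos; lra.
  have [->|ut'] := eqVneq u t1; first by rewrite xt1.
  by apply/ltW/bef; rewrite u0 lt_neqAle ut'.
(* the orbit passes x = x1, then x = M0 *)
have [|s /andP[s0 st1] xs] := ivt_incr x_cont (ltW t1_0) (v := x1).
  by rewrite x_0 xt1 x01; lra.
have [|s' /andP[ss' s't1] xs'] := ivt_incr x_cont st1 (v := M0).
  by rewrite xs xt1; lra.
have xp u : s <= u <= t1 -> 0 < x u.
  move=> /andP[su ut]; have [u0|u0] := ltP 0 u; first by apply: xpos; lra.
  by have -> : u = s by [lra]; rewrite xs; lra.
have s't1' : s' < t1.
  by rewrite lt_neqAle s't1 andbT; apply/eqP => E; move: xt1; rewrite -E xs'; lra.
have on u v : s <= u -> v <= t1 ->
    forall w, u <= w <= v -> 0 < x w /\ half_field_at a b2 b3 x y w.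
  by move=> su vt w wuv; split; [apply: xp|apply: odeon]; lra.
(* the abscissa increases at some later time, so the ratio is positive there *)
have dx u : u \in `]s', t1[ -> is_derive u 1 x (y u - a * x u ^+ 2).
  by rewrite in_itv/= => ut; have [] := odeon u ltac:(lra).
have [c] := MVT s't1' dx (continuous_subspaceT x_cont).
rewrite in_itv/= xt1 xs' => s'ct E.
have xc : 0 < x c by apply: xp; lra.
have rc : 0 < y c / x c ^+ 2 - a.
  have : 0 < y c - a * x c ^+ 2.
    have t1s' : 0 < t1 - s' by lra.
    by rewrite -(pmulr_lgt0 _ t1s') -E; lra.
  have -> : y c - a * x c ^+ 2 = (y c / x c ^+ 2 - a) * x c ^+ 2.
    by field; rewrite gt_eqF.
  by rewrite pmulr_lgt0// exprn_gt0.
have rs' : 0 < y s' / x s' ^+ 2 - a.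
  have s'c : s' <= c by lra.
  have c1 : c <= t1 by lra.
  have xp0 u : s' <= u <= c -> 0 <= x u by move=> us'; apply/ltW/xp; lra.
  have := ratio_decr b2_ge0 k_gt0 k_coercive s'c (on s' c ss' c1) xp0.
  by rewrite mulr0 mul0r subr0; exact: lt_le_trans rc.
have := ln_plus_ratio_decr b2_ge0 k_gt0 k_coercive ss' (on s s' (lexx _) s't1).
have ys : y s <= `|y0|.
  apply: le_trans (ler_norm _); rewrite -y_0; apply: (ordinate_nonincr (x := x) s0).
  move=> u us; split; last by apply: odeon; lra.
  have [<-|un0] := eqVneq 0 u; first by rewrite x_0.
  have up : 0 < u by rewrite lt_neqAle un0 (andP us).1.
  by apply/ltW/xpos; lra.
have rs : y s / x s ^+ 2 - a <= `|y0| + `|a|.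
  rewrite lerD//; last by rewrite -normrN ler_norm.
  rewrite xs ler_pdivrMr ?exprn_gt0 ?(lt_le_trans ltr01)//.
  by rewrite (le_trans ys)// ler_peMr// exprn_ege1.
have lnM : 4 * k * ln M0 = 4 * k * ln x1 + (`|y0| + `|a| + 1).
  rewrite /M0 lnM ?posrE ?expR_gt0 ?(lt_le_trans ltr01)// expRK.
  by field; rewrite gt_eqF.
by rewrite xs xs' in rs rs' *; lra.
Qed.

(** An orbit that stayed forever in x > 0 would reach negative values of r
    that are as large as desired; from there on y, hence x', is negative and
    bounded away from 0. *)
Lemma right_excursion_ends : exists2 t, 0 < t & x t <= 0.
Proof.
apply: contrapT => no_t.
have xpos t : 0 < t -> 0 < x t.
  by move=> t0; rewrite ltNge; apply/negP => xt; apply: no_t; exists t.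
have odeon t : 0 < t -> 0 < x t /\ half_field_at a b2 b3 x y t.
  move=> t0; split; first exact: xpos.
  apply: ode; first exact: ltW.
  rewrite !ltW ?xpos//; apply: right_excursion_bound; first exact: ltW.
  by move=> u /andP[u0 _]; exact: xpos.
have on s t : 0 < s -> forall u, s <= u <= t -> 0 < x u /\ half_field_at a b2 b3 x y u.
  by move=> s0 u su; apply: odeon; lra.
(* otherwise x would be bounded below, and r would decrease at least linearly *)
have [t2 t21 rt2] : exists2 t, 1 <= t & y t / x t ^+ 2 - a <= - (2 * `|a| + 1).
  apply: contrapT => no_r.
  have rbig t : 1 <= t -> - (2 * `|a| + 1) < y t / x t ^+ 2 - a.
    by move=> t1; rewrite ltNge; apply/negP => rt; apply: no_r; exists t.
  pose c := 4 * k * ln (x 1) - (y 1 / x 1 ^+ 2 - a) - (2 * `|a| + 1).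
  pose X := expR (c / (4 * k)).
  have X0 : 0 < X by exact: expR_gt0.
  have xX t : 1 <= t -> X <= x t.
    move=> t1; have xt : 0 < x t by apply: xpos; lra.
    rewrite -ler_ln ?posrE// expRK ler_pdivrMr ?mulr_gt0// mulrC.
    have := ln_minus_ratio_incr b2_ge0 k_gt0 k_coercive t1 (on 1 t ltr01).
    by have := rbig t t1; rewrite /c; lra.
  pose D := `|y 1 / x 1 ^+ 2 - a| + (2 * `|a| + 1).
  have D0 : 0 <= D by rewrite addr_ge0// addr_ge0// mulr_ge0.
  pose t := 1 + D / (2 * k * X).
  have t1 : 1 <= t by rewrite lerDl divr_ge0// !mulr_ge0// ltW.
  have xX1 u : 1 <= u <= t -> X <= x u by move=> /andP[u1 _]; exact: xX.
  have := ratio_decr b2_ge0 k_gt0 k_coercive t1 (on 1 t ltr01) xX1.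
  have -> : 2 * k * X * (t - 1) = D.
    by rewrite /t; field; rewrite !gt_eqF.
  have := rbig t t1; have := ler_norm (y 1 / x 1 ^+ 2 - a); rewrite /D; lra.
have t2_0 : 0 < t2 by lra.
have rafter t : t2 <= t -> y t / x t ^+ 2 - a <= - (2 * `|a| + 1).
  move=> t2t; have xp0 u : t2 <= u <= t -> 0 <= x u by move=> ut; apply/ltW/xpos; lra.
  have := ratio_decr b2_ge0 k_gt0 k_coercive t2t (on t2 t t2_0) xp0.
  by rewrite mulr0 mul0r; lra.
have na := normr_ge0 a.
have yx t : t2 <= t -> y t <= - ((`|a| + 1) * x t ^+ 2).
  move=> t2t; have xt : 0 < x t by apply: xpos; lra.
  have x2 : 0 < x t ^+ 2 by rewrite exprn_gt0.
  have := rafter t t2t; have := ler_norm a => aa rt.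
  rewrite -mulNr -ler_pdivrMr//; lra.
pose eta := - y t2.
have eta0 : 0 < eta.
  rewrite oppr_gt0; apply: le_lt_trans (yx t2 (lexx _)) _.
  by rewrite oppr_lt0 mulr_gt0 ?exprn_gt0 ?xpos//; lra.
have ydec t : t2 <= t -> y t <= - eta.
  move=> t2t; rewrite opprK; apply: (ordinate_nonincr (x := x) t2t).
  by move=> u us; have [xu ou] := odeon u ltac:(lra); split; [exact: ltW|].
have n1 : 0 < `|a| + 1 by lra.
have xdec t : t2 <= t -> y t - a * x t ^+ 2 <= - (eta / (`|a| + 1)).
  move=> t2t; have h1 := yx t t2t; have h2 := ydec t t2t.
  have x2 := sqr_ge0 (x t).
  have h3 : - a * x t ^+ 2 <= `|a| * x t ^+ 2.
    by rewrite ler_wpM2r// -normrN ler_norm.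
  rewrite -[leRHS]mulNr ler_pdivlMr//.
  have h4 : `|a| * y t <= `|a| * - ((`|a| + 1) * x t ^+ 2) by rewrite ler_wpM2l.
  have h5 : (`|a| + 1) * (y t - a * x t ^+ 2) <= (`|a| + 1) * (y t + `|a| * x t ^+ 2).
    by rewrite ler_pM2l//; lra.
  by lra.
pose t := t2 + x t2 * (`|a| + 1) / eta.
have xt2 := xpos t2 t2_0.
have t2t : t2 <= t by rewrite lerDl divr_ge0// ?mulr_ge0// ltW.
have dx (u : R) : t2 <= u <= t -> is_derive u 1 x (y u - a * x u ^+ 2).
  by move=> ut; have [_ []] := odeon u ltac:(lra).
have dxle u : t2 <= u <= t -> y u - a * x u ^+ 2 <= - (eta / (`|a| + 1)).
  by move=> ut; apply: xdec; lra.
have := mvt_segment_le t2t dx dxle.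
have -> : - (eta / (`|a| + 1)) * (t - t2) = - x t2.
  by rewrite /t; field; rewrite !gt_eqF.
have : 0 < x t by apply: xpos; lra.
by lra.
Qed.

Hypothesis start : 0 < x0 \/ 0 < y0.

Lemma right_excursion : exists T, [/\ 0 < T, x T = 0, y T < 0,
  forall t, 0 < t < T -> 0 < x t & forall t, 0 <= t <= T -> 0 <= x t <= M0 + 1].
Proof.
have M0p : 0 < M0 by apply: lt_trans x1_lt_M0; exact: lt_le_trans x1_ge1.
have [t t0 xt] := right_excursion_ends.
have [d /andP[d0 dt] xd] : exists2 d, 0 <= d < t &
    (forall u, 0 < u <= d -> 0 < x u) /\ 0 < x d.
  have [x0p|x00] := ltP 0 x0.
    exists 0; rewrite ?lexx// x_0; split => // u; lra.
  have x0E : x0 = 0 by apply/eqP; rewrite eq_le x00.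
  have y0p : 0 < y0 by case: start => //; rewrite x0E ltxx.
  have [dx _] : half_field_at a b2 b3 x y 0.
    by apply: ode => //; rewrite x_0 x0E lexx/=; lra.
  rewrite x_0 x0E y_0 expr0n mulr0 subr0 in dx.
  have [e e0 eP] := derive_pos_local dx y0p.
  have xh h : 0 < h < e -> 0 < x h.
    by move=> /eP /andP[_]; rewrite x_0 x0E add0r.
  exists (Num.min e t / 2).
    have : 0 < Num.min e t by rewrite lt_min e0.
    have : Num.min e t <= t by rewrite ge_min lexx orbT.
    by move=> *; apply/andP; split; lra.
  have m0 : 0 < Num.min e t by rewrite lt_min e0.
  have me : Num.min e t <= e by rewrite ge_min lexx.
  by split=> [u ud|]; apply: xh; lra.
case: xd => xd xd0.
have [T [dT Tt xT bef]] := first_hit_down x_cont (ltW dt) xd0 xt.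
have T0 : 0 < T by lra.
have xpos u : 0 < u < T -> 0 < x u.
  move=> uT; have [ud|ud] := leP u d; first by apply: xd; lra.
  by apply: bef; lra.
have xM u : 0 < u < T -> 0 < x u < M0 + 1.
  move=> uT; rewrite xpos//; apply: right_excursion_bound; first by lra.
  by move=> v vu; apply: xpos; lra.
have xM' u : 0 <= u <= T -> 0 <= x u <= M0 + 1.
  move=> uT; have x1M := x1_lt_M0; have x01 := x0_le_x1.
  have [->|u0] := eqVneq u 0; first by rewrite x_0 x0_ge0; lra.
  have [->|un] := eqVneq u T; first by rewrite xT lexx; lra.
  have uT' : 0 < u < T by rewrite !lt_neqAle eq_sym u0 un.
  by have := xM u uT'; lra.
exists T; split => //.
have odeon u : 0 < u <= T -> half_field_at a b2 b3 x y u.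
  by move=> uT; apply: ode; [|apply: xM']; lra.
(* if y T >= 0, then r >= - |a| before T, so that x stays away from 0 *)
rewrite ltNge; apply/negP => yT.
have ynn u : 0 < u <= T -> 0 <= y u.
  move=> uT; have uT' : u <= T by lra.
  apply: le_trans yT _; apply: (ordinate_nonincr (x := x) uT').
  move=> v vs; split; last by apply: odeon; lra.
  have [->|vT] := eqVneq v T; first by rewrite xT.
  have vltT : v < T by rewrite lt_neqAle vT (andP vs).2.
  by apply/ltW/xpos; lra.
pose s := T / 2.
have sT : 0 < s < T by rewrite /s; lra.
have xs := xpos s sT.
pose c := 4 * k * ln (x s) - (y s / x s ^+ 2 - a) - `|a|.
pose X := expR (c / (4 * k)).
have X0 : 0 < X by exact: expR_gt0.
have xX t' : s <= t' < T -> X <= x t'.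
  move=> t1; have xt' : 0 < x t' by apply: xpos; lra.
  rewrite -ler_ln ?posrE// expRK ler_pdivrMr ?mulr_gt0// mulrC.
  have st' : s <= t' by lra.
  have on u : s <= u <= t' -> 0 < x u /\ half_field_at a b2 b3 x y u.
    by move=> us; split; [apply: xpos|apply: odeon]; lra.
  have := ln_minus_ratio_incr b2_ge0 k_gt0 k_coercive st' on.
  have : 0 <= y t' / x t' ^+ 2 by rewrite divr_ge0 ?ynn ?exprn_ge0 ?ltW//; lra.
  have := ler_norm a; rewrite /c; lra.
have sT' : s <= T by lra.
have [|v svT xv] := ivt_decr x_cont sT' (v := Num.min X (x s) / 2).
  have m0 : 0 < Num.min X (x s) by rewrite lt_min X0.
  have m1 : Num.min X (x s) <= x s by rewrite ge_min lexx orbT.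
  by rewrite xT; lra.
have m0 : 0 < Num.min X (x s) by rewrite lt_min X0.
have m1 : Num.min X (x s) <= X by rewrite ge_min lexx.
have [vT|vT] := ltP v T; first by have := xX v ltac:(lra); lra.
by move: xv; have -> : v = T by [lra]; rewrite xT; lra.
Qed.

End Bound.

(** An orbit that starts in the half plane x >= 0, not on the closed negative y
    axis, leaves it through the open negative y axis.  The bound M depends on the
    starting point only, and the system need hold only as long as x <= M, so
    that the result applies to a system truncated at M. *)
Theorem half_orbit (x0 y0 : R) : 0 <= x0 -> 0 < x0 \/ 0 < y0 ->
  exists2 M : R, 0 < M & forall x y : R -> R, continuous x ->
    x 0 = x0 -> y 0 = y0 ->
    (forall t, 0 <= t -> 0 <= x t <= M -> half_field_at a b2 b3 x y t) ->
    exists T, [/\ 0 < T, x T = 0, y T < 0, forall t, 0 < t < T -> 0 < x t &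
      forall t, 0 <= t <= T -> 0 <= x t <= M].
Proof.
move=> x00 start; have [k k0 kP] := quadratic_coercive ab3.
exists (Num.max x0 1 * expR ((`|y0| + `|a| + 1) / (4 * k)) + 1).
  by rewrite ltr_pwDr// mulr_ge0 ?expR_ge0// le_max x00.
by move=> x y cx xE yE ode; exact: (right_excursion k0 kP).
Qed.

End HalfOrbit.

(** * Closed orbits *)

Section Truncation.
Context {R : realType}.
Implicit Types (u v c M : R).

(** The projection of the real line onto [- M, M], for M >= 0. *)
Definition clamp M u : R := Num.max (- M) (Num.min u M).

Lemma clamp_id M u : - M <= u <= M -> clamp M u = u.
Proof. by move=> /andP[Mu uM]; rewrite /clamp (min_idPl uM) (max_idPr Mu). Qed.

Lemma clampN M u : 0 <= M -> clamp M (- u) = - clamp M u.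
Proof.
move=> M0; rewrite /clamp.
case: (leP u M) => h1; case: (leP (- u) M) => h2;
  case: (leP (- M) (- u)) => h3; case: (leP (- M) u) => h4;
  case: (leP (- M) M) => h5; lra.
Qed.

Lemma clamp_bound M u : 0 <= M -> - M <= clamp M u <= M.
Proof.
by move=> M0; rewrite le_max lexx ge_max ge_min lexx orbT andbT/= ge0_cp.
Qed.

Lemma max_lip c u v : `|Num.max c u - Num.max c v| <= `|u - v|.
Proof.
rewrite ler_norml; have := ler_norm (u - v); have := ler_norm (- (u - v)).
by rewrite normrN; case: (leP c u); case: (leP c v) => *; apply/andP; split; lra.
Qed.

Lemma min_lip c u v : `|Num.min u c - Num.min v c| <= `|u - v|.
Proof.
rewrite ler_norml; have := ler_norm (u - v); have := ler_norm (- (u - v)).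
by rewrite normrN; case: (leP u c); case: (leP v c) => *; apply/andP; split; lra.
Qed.

Lemma clamp_lip M u v : `|clamp M u - clamp M v| <= `|u - v|.
Proof. exact: le_trans (max_lip _ _ _) (min_lip _ _ _). Qed.

Lemma sqr_lip M u v : - M <= u <= M -> - M <= v <= M ->
  `|u ^+ 2 - v ^+ 2| <= 2 * M * `|u - v|.
Proof.
move=> uM vM; have -> : u ^+ 2 - v ^+ 2 = (u + v) * (u - v) by ring.
by rewrite normrM ler_wpM2r// ler_norml; apply/andP; split; lra.
Qed.

Lemma cube_lip M u v : - M <= u <= M -> - M <= v <= M ->
  `|u ^+ 3 - v ^+ 3| <= 3 * M ^+ 2 * `|u - v|.
Proof.
move=> uM vM; have -> : u ^+ 3 - v ^+ 3 = (u ^+ 2 + u * v + v ^+ 2) * (u - v) by ring.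
rewrite normrM ler_wpM2r//.
have s1 := sqr_ge0 (u + v); have s2 := sqr_ge0 u; have s3 := sqr_ge0 v.
rewrite ger0_norm; last by lra.
have : u ^+ 2 <= M ^+ 2 by nra.
have : v ^+ 2 <= M ^+ 2 by nra.
by have := sqr_ge0 (u - v); lra.
Qed.

Lemma cubic_lip M b2 b3 u v : - M <= u <= M -> - M <= v <= M ->
  `|(b2 * u ^+ 2 + b3 * u ^+ 3) - (b2 * v ^+ 2 + b3 * v ^+ 3)|
  <= (2 * M * `|b2| + 3 * M ^+ 2 * `|b3|) * `|u - v|.
Proof.
move=> uM vM; have := sqr_lip uM vM; have := cube_lip uM vM => h3 h2.
have -> : (b2 * u ^+ 2 + b3 * u ^+ 3) - (b2 * v ^+ 2 + b3 * v ^+ 3) =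
  b2 * (u ^+ 2 - v ^+ 2) + b3 * (u ^+ 3 - v ^+ 3) by ring.
apply: le_trans (ler_normD _ _) _; rewrite !normrM.
have h4 := ler_wpM2l (normr_ge0 b2) h2.
have h5 := ler_wpM2l (normr_ge0 b3) h3.
lra.
Qed.

End Truncation.

Section Lienard.
Context {R : realType}.
Variables (a b2p b3p b2m b3m : R).
Hypotheses (b2p_ge0 : 0 <= b2p) (b2m_le0 : b2m <= 0).
Hypotheses (ab3p : a ^+ 2 / 2 < b3p) (ab3m : a ^+ 2 / 2 < b3m).

(** The restoring force; the equation reads x' = y - a x^2, y' = - force x on
    both sides of the switching line. *)
Definition force (u : R) : R :=
  if 0 <= u then b2p * u ^+ 2 + b3p * u ^+ 3 else b2m * u ^+ 2 + b3m * u ^+ 3.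

(** (x, y) obeys x' = y - phi x, y' = - psi x at time t. *)
Definition planar_at (phi psi x y : R -> R) (t : R) : Prop :=
  is_derive t 1 x (y t - phi (x t)) /\ is_derive t 1 y (- psi (x t)).

Notation friction := (fun u : R => a * u ^+ 2).

(** (x, y) obeys the switching system, as a single system, at time t. *)
Definition lienard_at := planar_at friction force.

Lemma force_pos u : 0 <= u -> force u = b2p * u ^+ 2 + b3p * u ^+ 3.
Proof. by rewrite /force => ->. Qed.

Lemma force_neg u : u <= 0 -> force u = b2m * u ^+ 2 + b3m * u ^+ 3.
Proof.
rewrite /force le_eqVlt => /predU1P[->|u0]; last by rewrite leNgt u0.
by rewrite lexx !expr0n !mulr0.
Qed.

Lemma field_lip M : 0 <= M -> exists2 L, 0 <= L & forall u v,
  - M <= u <= M -> - M <= v <= M ->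
  `|friction u - friction v| <= L * `|u - v| /\
  `|force u - force v| <= L * `|u - v|.
Proof.
move=> M0.
pose L1 := 2 * M * `|b2p| + 3 * M ^+ 2 * `|b3p|.
pose L2 := 2 * M * `|b2m| + 3 * M ^+ 2 * `|b3m|.
pose L3 := 2 * M * `|a|.
have M2 := sqr_ge0 M.
have L10 : 0 <= L1 by rewrite addr_ge0// mulr_ge0// mulr_ge0.
have L20 : 0 <= L2 by rewrite addr_ge0// mulr_ge0// mulr_ge0.
have L30 : 0 <= L3 by rewrite mulr_ge0// mulr_ge0.
exists (L1 + L2 + L3); first by lra.
move=> u v uM vM; have n0 := normr_ge0 (u - v); split.
  have -> : a * u ^+ 2 - a * v ^+ 2 = a * (u ^+ 2 - v ^+ 2) by ring.
  rewrite normrM; have := ler_wpM2l (normr_ge0 a) (sqr_lip uM vM).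
  have := mulr_ge0 L10 n0; have := mulr_ge0 L20 n0; rewrite /L3; lra.
(* the force is a sum of two polynomials in the positive and negative parts *)
have forceE w : force w =
    (b2p * Num.max 0 w ^+ 2 + b3p * Num.max 0 w ^+ 3) +
    (b2m * Num.min w 0 ^+ 2 + b3m * Num.min w 0 ^+ 3).
  rewrite /force; case: (leP 0 w) => w0; rewrite ?(min_idPr w0) ?(min_idPl (ltW w0)).
    by rewrite !expr0n/= !mulr0 !addr0.
  by rewrite !expr0n/= !mulr0 !add0r.
have pos w : - M <= w <= M -> - M <= Num.max 0 w <= M.
  by move=> wM; case: (leP 0 w) => *; lra.
have neg w : - M <= w <= M -> - M <= Num.min w 0 <= M.
  by move=> wM; case: (leP w 0) => *; lra.
have h1 := cubic_lip b2p b3p (pos u uM) (pos v vM).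
have h2 := cubic_lip b2m b3m (neg u uM) (neg v vM).
rewrite -/L1 -/L2 in h1 h2.
rewrite !forceE opprD addrACA; apply: le_trans (ler_normD _ _) _.
have h3 := ler_wpM2l L10 (max_lip 0 u v).
have h4 := ler_wpM2l L20 (min_lip 0 u v).
have := mulr_ge0 L30 n0; lra.
Qed.

Section Uniqueness.
Variables (x1 y1 x2 y2 : R -> R) (s t c : R).
Hypotheses (sct : s <= c <= t) (xc : x1 c = x2 c) (yc : y1 c = y2 c).

Lemma lienard_unique :
  (forall u, s <= u <= t -> lienard_at x1 y1 u) ->
  (forall u, s <= u <= t -> lienard_at x2 y2 u) ->
  forall u, s <= u <= t -> x1 u = x2 u /\ y1 u = y2 u.
Proof.
move=> h1 h2.
have bounded (x y : R -> R) : (forall u, s <= u <= t -> lienard_at x y u) ->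
    exists2 M, 0 <= M & forall u, s <= u <= t -> `|x u| <= M.
  move=> h; have st : s <= t by have := sct; lra.
  have cx : {within `[s, t], continuous (fun u => `|x u|)}.
    have : {within `[s, t], continuous x} by apply: is_derive_within => u /h [+ _].
    by move=> cx u; apply: cvg_norm; exact: cx.
  have [d _ dM] := EVT_max st cx.
  by exists `|x d| => // u ut; apply: dM; rewrite in_itv.
have [M1 M10 M1P] := bounded _ _ h1; have [M2 M20 M2P] := bounded _ _ h2.
have [L L0 LP] := @field_lip (M1 + M2) ltac:(lra).
apply: (planar_unique L0 sct xc yc h1 h2) => u ut.
by apply: LP; rewrite -ler_norml; [have := M1P u ut|have := M2P u ut]; lra.
Qed.

Variable M : R.
Hypothesis M_ge0 : 0 <= M.

Lemma truncated_unique :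
  (forall u, planar_at (friction \o clamp M) (force \o clamp M) x1 y1 u) ->
  (forall u, planar_at (friction \o clamp M) (force \o clamp M) x2 y2 u) ->
  forall u, s <= u <= t -> x1 u = x2 u /\ y1 u = y2 u.
Proof.
move=> h1 h2; have [L L0 LP] := field_lip M_ge0.
apply: (planar_unique L0 sct xc yc (fun u _ => h1 u) (fun u _ => h2 u)) => u ut.
have [p1 p2] := LP _ _ (clamp_bound (x1 u) M_ge0) (clamp_bound (x2 u) M_ge0).
have q := ler_wpM2l L0 (clamp_lip M (x1 u) (x2 u)).
by split; [exact: le_trans p1 q|exact: le_trans p2 q].
Qed.

End Uniqueness.

(** Truncation in x alone makes the system globally Lipschitz. *)
Lemma truncated_solution M x0 y0 : 0 <= M -> exists x y : R -> R,
  [/\ x 0 = x0, y 0 = y0 &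
  forall t, planar_at (friction \o clamp M) (force \o clamp M) x y t].
Proof.
move=> M0; have [L L0 LP] := field_lip M0.
pose F (i : bool) (z : bool -> R) : R :=
  if i then z false - a * clamp M (z true) ^+ 2 else - force (clamp M (z true)).
have L1 : 0 < 1 + L by lra.
have Flip i (u v : bool -> R) d :
    (forall j, `|u j - v j| <= d) -> `|F i u - F i v| <= (1 + L) * d.
  move=> uv; have [p1 p2] := LP _ _ (clamp_bound (u true) M0) (clamp_bound (v true) M0).
  have q : L * `|clamp M (u true) - clamp M (v true)| <= L * d.
    by apply: ler_wpM2l => //; exact: le_trans (clamp_lip _ _ _) (uv true).
  have d0 : 0 <= d by apply: le_trans (uv true).
  rewrite mulrDl mul1r; case: i => /=.
    have -> : u false - a * clamp M (u true) ^+ 2 - (v false - a * clamp M (v true) ^+ 2)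
      = (u false - v false) - (a * clamp M (u true) ^+ 2 - a * clamp M (v true) ^+ 2).
      by ring.
    apply: le_trans (ler_normB _ _) _; apply: lerD; first exact: uv.
    exact: le_trans p1 q.
  rewrite opprK addrC distrC; apply: le_trans (le_trans p2 q) _.
  by rewrite lerDr.
have [z [z0 zP]] := global_solution L1 Flip (fun i => if i then x0 else y0).
exists (z true), (z false); split; [exact: (z0 true)|exact: (z0 false)|move=> t].
by split; [exact: (zP true t)|exact: (zP false t)].
Qed.

End Lienard.

Section ClosedOrbits.
Context {R : realType}.

(** For a = 0 the energy y^2 / 2 + b2 x^3 / 3 + b3 x^4 / 4 is conserved. *)
Lemma half_energy (b2 b3 : R) (x y : R -> R) (T : R) : 0 <= T ->
  (forall t, 0 <= t <= T -> half_field_at 0 b2 b3 x y t) ->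
  x 0 = 0 -> x T = 0 -> y T ^+ 2 = y 0 ^+ 2.
Proof.
move=> T0 ode x0 xT.
pose E t := y t ^+ 2 / 2 + b2 / 3 * x t ^+ 3 + b3 / 4 * x t ^+ 4.
have dE (t : R) : 0 <= t <= T -> is_derive t 1 E 0.
  by move=> /ode[dx dy]; rewrite /E; derive_eq; field.
have h1 := mvt_segment_le T0 dE (fun t _ => lexx 0).
have h2 := mvt_segment_ge T0 dE (fun t _ => lexx 0).
by move: h1 h2; rewrite /E x0 xT !expr0n /= !mulr0 !addr0; lra.
Qed.

Lemma periodic_representative (P c t : R) : 0 < P -> exists2 s, c <= s < c + P &
  forall f : R -> R, (forall u, f (u + P) = f u) -> f s = f t.
Proof.
move=> P0; pose n := Num.floor ((t - c) / P).
have nP : n%:~R * P <= t - c < n%:~R * P + P.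
  have := floor_itv ((t - c) / P); rewrite -/n => /andP[n1 n2].
  rewrite -ler_pdivlMr// n1/=.
  by move: n2; rewrite ltr_pdivrMr// intrD mulrDl mul1r.
exists (t - n%:~R * P); first by lra.
move=> f fP.
have fn k u : f (u + k%:R * P) = f u.
  elim: k => [|k IH]; first by rewrite mul0r addr0.
  by rewrite -addn1 natrD mulrDl mul1r addrA fP.
have fz (m : int) u : f (u + m%:~R * P) = f u.
  case: m => k; first exact: fn.
  by have := fn k.+1 (u + (Negz k)%:~R * P); rewrite NegzE mulrNz mulNr subrK.
by have := fz n (t - n%:~R * P); rewrite subrK.
Qed.

Variables (a b2p b3p b2m b3m : R).
Hypotheses (b2p_ge0 : 0 <= b2p) (b2m_le0 : b2m <= 0).
Hypotheses (ab3p : a ^+ 2 / 2 < b3p) (ab3m : a ^+ 2 / 2 < b3m).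
Notation force := (force b2p b3p b2m b3m).
Notation friction := (fun u : R => a * u ^+ 2).
Notation lienard_at := (lienard_at a b2p b3p b2m b3m).
Notation truncated_at M := (planar_at (friction \o clamp M) (force \o clamp M)).

Lemma truncated_lienard M x y t : `|x t| <= M -> truncated_at M x y t ->
  lienard_at x y t.
Proof.
by rewrite ler_norml /lienard_at /planar_at /= => xM; rewrite (clamp_id xM).
Qed.

Lemma lienard_right x y t : 0 <= x t -> lienard_at x y t ->
  half_field_at a b2p b3p x y t.
Proof. by move=> xt [dx]; rewrite (force_pos _ _ _ _ xt). Qed.

(** The reflections (x, t) |-> (- x, - t), (x, y) |-> (- x, - y) and
    (y, t) |-> (- y, - t) lead back to forward orbits in the half plane x >= 0;
    the last two replace a by - a. *)
Lemma lienard_left_backward x y t : x (- t) <= 0 -> lienard_at x y (- t) ->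
  half_field_at a (- b2m) b3m (fun s => - x (- s)) (fun s => y (- s)) t.
Proof.
move=> xt [dx]; rewrite (force_neg _ _ _ _ xt) => dy.
have dx' := is_derive_opp_arg dx; have dy' := is_derive_opp_arg dy.
by split; derive_eq; ring.
Qed.

Lemma lienard_left_forward x y t : x t <= 0 -> lienard_at x y t ->
  half_field_at (- a) (- b2m) b3m (fun s => - x s) (fun s => - y s) t.
Proof.
move=> xt [dx]; rewrite (force_neg _ _ _ _ xt) => dy.
by split; derive_eq; ring.
Qed.

Lemma lienard_right_backward x y t : 0 <= x (- t) -> lienard_at x y (- t) ->
  half_field_at (- a) b2p b3p (fun s => x (- s)) (fun s => - y (- s)) t.
Proof.
move=> xt [dx]; rewrite (force_pos _ _ _ _ xt) => dy.
have dx' := is_derive_opp_arg dx; have dy' := is_derive_opp_arg dy.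
by split; derive_eq; ring.
Qed.

Lemma planar_at_shift phi psi (x y : R -> R) c t :
  planar_at phi psi x y (t + c) ->
  planar_at phi psi (fun s => x (s + c)) (fun s => y (s + c)) t.
Proof.
by move=> [dx dy]; split; [exact: is_derive_shift_arg dx|exact: is_derive_shift_arg dy].
Qed.

Lemma planar_at_continuous phi psi (x y : R -> R) :
  (forall t, planar_at phi psi x y t) -> continuous x /\ continuous y.
Proof.
by move=> h; split=> t; have [dx dy] := h t;
  [exact: is_derive_continuous dx|exact: is_derive_continuous dy].
Qed.

Hypothesis closing : a = 0 \/ b2m = - b2p /\ b3m = b3p.

(** A solution of period S + T that starts at (0, y0), y0 > 0, runs through the
    half plane x > 0 on ]0, T[ and through x < 0 on ]- S, 0[, and meets the
    negative y axis at time T. *)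
Definition closed_solution (y0 S T : R) (x y : R -> R) : Prop :=
  [/\ [/\ 0 < y0, 0 < S, 0 < T, x 0 = 0 & y 0 = y0],
      [/\ x T = 0, y T < 0, forall t, 0 < t < T -> 0 < x t &
        forall t, - S < t < 0 -> x t < 0],
      forall t, lienard_at x y t,
      forall t, x (t + (S + T)) = x t &
      forall t, y (t + (S + T)) = y t].

(** The orbit of (0, y0) meets the negative y axis forwards and backwards.  The
    two points coincide by conservation of the energy if a = 0, and by
    reversibility if the force is odd. *)
Lemma closed_solution_exists y0 : 0 < y0 ->
  exists S T x y, closed_solution y0 S T x y.
Proof.
move=> y0_gt0.
have [M1 M10 M1P] := half_orbit b2p_ge0 ab3p (lexx 0) (or_intror y0_gt0).
have b2m' : 0 <= - b2m by rewrite oppr_ge0.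
have [M2 M20 M2P] := half_orbit b2m' ab3m (lexx 0) (or_intror y0_gt0).
pose M := M1 + M2; have M0 : 0 <= M by rewrite /M; lra.
have [x [y [x0 y0E tr]]] := truncated_solution a b2p b3p b2m b3m 0 y0 M0.
have [cx _] := planar_at_continuous tr.
have lie t : - M2 <= x t <= M1 -> lienard_at x y t.
  by move=> xt; apply: truncated_lienard (tr t); rewrite ler_norml /M; lra.
have [|T [T0 xT yT xpos xM]] := M1P x y cx x0 y0E.
  by move=> t _ xt; apply: lienard_right; [|apply: lie]; lra.
have [||||S [S0 xS yS xneg xN]] := M2P (fun t => - x (- t)) (fun t => y (- t)).
- by move=> t; apply: cvgN; exact: (continuous_opp_arg cx).
- by rewrite oppr0 x0 oppr0.
- by rewrite oppr0.
- by move=> t _ xt; apply: lienard_left_backward; [|apply: lie]; lra.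
have xS' : x (- S) = 0 by lra.
have xneg' t : - S < t < 0 -> x t < 0.
  by move=> tS; have := xneg (- t) ltac:(lra); rewrite opprK; lra.
have xN' t : - S <= t <= 0 -> - M2 <= x t <= 0.
  by move=> tS; have := xN (- t) ltac:(lra); rewrite opprK; lra.
have yclose : y (- S) = y T.
  have [a0|[eb2 eb3]] := closing.
    have e1 : y T ^+ 2 = y 0 ^+ 2.
      apply: (@half_energy b2p b3p x y) => //; first exact: ltW.
      move=> t tT; have xt := xM t tT.
      by rewrite -a0; apply: lienard_right; [|apply: lie]; lra.
    have e2 : y (- S) ^+ 2 = y (- 0) ^+ 2.
      apply: (@half_energy (- b2m) b3m (fun t => - x (- t)) (fun t => y (- t))) => //.
      + exact: ltW.
      + move=> t tS; have xt := xN t tS.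
        by rewrite -a0; apply: lienard_left_backward; [|apply: lie]; lra.
      + by rewrite oppr0 x0 oppr0.
    move: e2; rewrite oppr0 -e1 => /eqP; rewrite eqf_sqr => /orP[/eqP//|/eqP]; lra.
  (* the system is reversible under (x, t) |-> (- x, - t) *)
  have tr' t : truncated_at M (fun t => - x (- t)) (fun t => y (- t)) t.
    have [dx dy] := tr (- t).
    have dx' := is_derive_opp_arg dx; have dy' := is_derive_opp_arg dy.
    have forceN u : force (- u) = - force u.
      have [u0|/ltW u0] := leP 0 u.
        rewrite (force_pos _ _ _ _ u0) force_neg ?oppr_le0// eb2 eb3; ring.
      rewrite (force_neg _ _ _ _ u0) force_pos ?oppr_ge0// eb2 eb3; ring.
    split; derive_eq; rewrite (clampN _ M0) ?forceN; ring.
  have sym t : - x (- t) = x t /\ y (- t) = y t.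
    pose N := `|t|; have tN : - N <= t <= N by rewrite -ler_norml.
    apply: (@truncated_unique R a b2p b3p b2m b3m _ _ x y (- N) N 0 _ _ _ M M0 tr' tr) => //.
    - by have := normr_ge0 t; rewrite /N; lra.
    - by rewrite oppr0 x0 oppr0.
    - by rewrite oppr0.
  have xS2 : x S = 0 by have [] := sym S; lra.
  have TS : T = S.
    apply/eqP; rewrite eq_le; apply/andP; split; rewrite leNgt; apply/negP => lt.
      by have := xpos S; rewrite S0 lt xS2 ltxx => /(_ isT).
    by have := xneg T; rewrite T0 lt (sym T).1 xT ltxx => /(_ isT).
  by rewrite TS (sym S).2.
have per t : x (t + (S + T)) = x t /\ y (t + (S + T)) = y t.
  pose N := `|t| + S.
  have tN : - N <= t <= N.
    by have := ler_norm t; have := ler_norm (- t); rewrite normrN /N; lra.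
  apply: (@truncated_unique R a b2p b3p b2m b3m (fun t => x (t + (S + T)))
    (fun t => y (t + (S + T))) x y (- N) N (- S) _ _ _ M M0 _ tr) => //.
  - by have := normr_ge0 t; rewrite /N; lra.
  - by rewrite addrA addNr add0r xT xS'.
  - by rewrite addrA addNr add0r yclose.
  - by move=> u; exact: planar_at_shift.
have bound t : - M2 <= x t <= M1.
  have [|s st sP] := @periodic_representative (S + T) (- S) t; first by rewrite addr_gt0.
  rewrite -(sP x (fun u => (per u).1)); rewrite addrA addNr add0r in st.
  have [s0|s0] := leP s 0; first by have := xN' s ltac:(lra); lra.
  by have := xM s ltac:(lra); lra.
exists S, T, x, y; split => //.
- by move=> t; exact: lie.
- by move=> t; have [] := per t.
- by move=> t; have [] := per t.
Qed.

(** Every point other than the origin lies on a closed orbit, because its orbit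
    reaches the positive y axis, forwards or backwards. *)
Lemma closed_solution_through (x0 y0 : R) : x0 != 0 \/ y0 != 0 ->
  exists v S T x y t, closed_solution v S T x y /\ x t = x0 /\ y t = y0.
Proof.
move=> nz.
have [/andP[/eqP x00 y0p]|np] := boolP ((x0 == 0) && (0 < y0)).
  have [S [T [x [y cs]]]] := closed_solution_exists y0p.
  by exists y0, S, T, x, y, 0; case: (cs) => -[_ _ _ -> ->] _ _ _ _; rewrite x00.
have aN : (- a) ^+ 2 / 2 = a ^+ 2 / 2 by rewrite sqrrN.
have [x0n|x0p] := ltP x0 0.
- have ab3m' : (- a) ^+ 2 / 2 < b3m by rewrite aN.
  have b2m' : 0 <= - b2m by rewrite oppr_ge0.
  have x0' : 0 < - x0 by rewrite oppr_gt0.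
  have [M M0 MP] := half_orbit b2m' ab3m' (ltW x0') (or_introl x0' : _ \/ 0 < - y0).
  have [x [y [xE yE tr]]] := truncated_solution a b2p b3p b2m b3m x0 y0 (ltW M0).
  have [cx _] := planar_at_continuous tr.
  have lie t : - M <= x t <= M -> lienard_at x y t.
    by move=> xt; apply: truncated_lienard (tr t); rewrite ler_norml.
  have [||||T [T0 xT yT xpos xpM]] := MP (fun t => - x t) (fun t => - y t).
  + by move=> t; apply: cvgN; exact: cx.
  + by rewrite xE.
  + by rewrite yE.
  + by move=> t _ xt; apply: lienard_left_forward; [|apply: lie]; lra.
  have yT' : 0 < y T by lra.
  have [S [T' [xc [yc cs]]]] := closed_solution_exists yT'.
  exists (y T), S, T', xc, yc, (- T); split => //.
  case: cs => -[_ _ _ xc0 yc0] _ lc _ _.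
  have -> : x0 = x (- T + T) by rewrite addNr.
  have -> : y0 = y (- T + T) by rewrite addNr.
  apply: (@lienard_unique R a b2p b3p b2m b3m xc yc (fun t => x (t + T))
     (fun t => y (t + T)) (- T) 0 0) => //.
  + by lra.
  + by rewrite add0r xc0; lra.
  + by rewrite add0r.
  + move=> u uT; apply: planar_at_shift; apply: lie.
    by have := xpM (u + T) ltac:(lra); lra.
  + by lra.
- have start : 0 < x0 \/ 0 < - y0.
    move: x0p; rewrite le_eqVlt => /predU1P[x00|]; [right|by left].
    case: nz; first by rewrite -x00 eqxx.
    by move: np; rewrite -x00 eqxx/= -leNgt oppr_gt0 lt_neqAle => -> ->.
  have ab3p' : (- a) ^+ 2 / 2 < b3p by rewrite aN.
  have [M M0 MP] := half_orbit b2p_ge0 ab3p' x0p start.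
  have [x [y [xE yE tr]]] := truncated_solution a b2p b3p b2m b3m x0 y0 (ltW M0).
  have [cx _] := planar_at_continuous tr.
  have lie t : - M <= x t <= M -> lienard_at x y t.
    by move=> xt; apply: truncated_lienard (tr t); rewrite ler_norml.
  have [||||T [T0 xT yT xpos xpM]] := MP (fun t => x (- t)) (fun t => - y (- t)).
  + exact: continuous_opp_arg.
  + by rewrite oppr0 xE.
  + by rewrite oppr0 yE.
  + by move=> t _ xt; apply: lienard_right_backward; [|apply: lie]; lra.
  have yT' : 0 < y (- T) by lra.
  have [S [T' [xc [yc cs]]]] := closed_solution_exists yT'.
  exists (y (- T)), S, T', xc, yc, T; split => //.
  case: cs => -[_ _ _ xc0 yc0] _ lc _ _.
  have -> : x0 = x (T + - T) by rewrite subrr.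
  have -> : y0 = y (T + - T) by rewrite subrr.
  apply: (@lienard_unique R a b2p b3p b2m b3m xc yc (fun t => x (t + - T))
     (fun t => y (t + - T)) 0 T 0) => //.
  + by rewrite lexx ltW.
  + by rewrite add0r xc0.
  + by rewrite add0r.
  + move=> u uT; apply: planar_at_shift; apply: lie.
    by have := xpM (- (u + - T)) ltac:(lra); rewrite opprK; lra.
  + by rewrite lexx ltW.
Qed.

End ClosedOrbits.

(** * Arcs and orbits of the switching system *)

Section SwitchingSolutions.
Context {R : realType}.

(** The point (x, y) of the plane. *)
Definition vec (x y : R) : plane R := \row_(i < 2) if i == 0 then x else y.

Lemma vec0E x y : vec x y 0 0 = x. Proof. by rewrite mxE eqxx. Qed.
Lemma vec1E x y : vec x y 0 1 = y. Proof. by rewrite mxE. Qed.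

Lemma ord2_cases (j : 'I_2) : j = 0 \/ j = 1.
Proof. by case: j => [[|[|//]] h]; [left|right]; exact: val_inj. Qed.

Lemma plane_eq (p q : plane R) : p 0 0 = q 0 0 -> p 0 1 = q 0 1 -> p = q.
Proof.
by move=> e0 e1; apply/rowP => j; have [->|->] := ord2_cases j.
Qed.

Lemma is_derive_planeP (g : R -> plane R) (t : R) (v : plane R) :
  is_derive t 1 g v <->
  is_derive t 1 (fun s => g s 0 0) (v 0 0) /\ is_derive t 1 (fun s => g s 0 1) (v 0 1).
Proof.
split=> [[dg <-]|[[d0 e0] [d1 e1]]].
  have /derivable_mxP dij := dg.
  by split; split; rewrite ?(derive_mx dg) ?mxE//; exact: dij.
have dg : derivable g t 1.
  apply/derivable_mxP => i j; rewrite ord1.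
  by have [->|->] := ord2_cases j; [exact: d0|exact: d1].
by split => //; rewrite (derive_mx dg); apply: plane_eq; rewrite mxE.
Qed.

Variables (a b2p b3p b2m b3m : R).
Notation force := (force b2p b3p b2m b3m).
Notation lienard_at := (lienard_at a b2p b3p b2m b3m).
Notation Fp := (lienard a 0 b2p b3p).
Notation Fm := (lienard a 0 b2m b3m).

Lemma lienardE b2 b3 (p : plane R) :
  lienard a 0 b2 b3 p = vec (p 0 1 - a * p 0 0 ^+ 2)
    (- (b2 * p 0 0 ^+ 2 + b3 * p 0 0 ^+ 3)).
Proof. by apply/rowP => i; rewrite !mxE mul0r addr0. Qed.

Lemma force_continuous : continuous force.
Proof.
move=> u; have M0 : 0 <= `|u| + 1 by rewrite addr_ge0.
have [L L0 LP] := field_lip a b2p b3p b2m b3m M0.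
apply/cvgrPdist_le => e e0; near=> v.
have uv1 : `|u - v| <= 1 by near: v; apply/nbhs_ballP; exists 1 => //= v; exact: ltW.
have uv2 : `|u - v| <= e / (L + 1).
  near: v; apply/nbhs_ballP; exists (e / (L + 1)); last by move=> v; exact: ltW.
  by rewrite /= divr_gt0// ltr_wpDl.
have vM : - (`|u| + 1) <= v <= `|u| + 1.
  have := ler_norm u; have := ler_norm (- u); rewrite normrN.
  by move: uv1; rewrite ler_norml; lra.
have uM : - (`|u| + 1) <= u <= `|u| + 1.
  by have := ler_norm u; have := ler_norm (- u); rewrite normrN; lra.
have [_ p] := LP u v uM vM; apply: le_trans p _.
have L1 : 0 < L + 1 by lra.
apply: (@le_trans _ _ ((L + 1) * `|u - v|)); first by rewrite ler_wpM2r// lerDl.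
by rewrite mulrC -ler_pdivlMr.
Unshelve. all: by end_near. Qed.

Lemma system_arc_lienard (s t : R) (g : R -> plane R) : system_arc Fp Fm s t g ->
  [/\ {within `[s, t], continuous (fun u => g u 0 0)},
      {within `[s, t], continuous (fun u => g u 0 1)} &
      forall u, s < u < t -> lienard_at (fun u => g u 0 0) (fun u => g u 0 1) u].
Proof.
have coord i : {within `[s, t], continuous g} ->
    {within `[s, t], continuous (fun u => g u 0 i)}.
  by move=> cg u; exact: cvg_comp (cg u) (@coord_continuous R 1 2 0 i (g u)).
case=> -[cg h]; (split; [exact: coord|exact: coord|]) => u /h [/= gu];
  rewrite lienardE => /is_derive_planeP[]; rewrite vec0E vec1E => dx dy; split => //.
- by rewrite (force_pos _ _ _ _ gu).
- by rewrite (force_neg _ _ _ _ (ltW gu)).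
Qed.

(** At a time where two arcs meet, continuity of the field makes the
    concatenation differentiable. *)
Lemma solution_lienard (I : set R) (g : R -> plane R) : solution Fp Fm I g ->
  forall t, I t -> lienard_at (fun u => g u 0 0) (fun u => g u 0 1) t.
Proof.
move=> [_ sol] t /sol[e e0 [/system_arc_lienard[lx ly lh] /system_arc_lienard[rx ry rh]]].
have te : t - e < t + e by lra.
have glue (f : R -> R) : {within `[t - e, t], continuous f} ->
    {within `[t, t + e], continuous f} -> {within `[t - e, t + e], continuous f}.
  move=> lf rf; have -> : `[t - e, t + e]%classic = `[t - e, t] `|` `[t, t + e].
    apply/seteqP; split=> u /=; rewrite !in_itv/=.
      by move=> /andP[u1 u2]; have [ut|/ltW tu] := leP u t; [left|right]; rewrite ?u1 ?u2 ?ut ?tu.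
    by case=> /andP[u1 u2]; apply/andP; split; lra.
  by apply: withinU_continuous => //; exact: interval_closed.
have cx := glue _ lx rx; have cy := glue _ ly ry.
have inter (f : R -> R) : {within `[t - e, t + e], continuous f} -> {for t, continuous f}.
  by move=> /(continuous_within_itvP _ te)[+ _ _]; apply; rewrite in_itv/=; lra.
have cxt := inter _ cx; have cyt := inter _ cy.
have h u : 0 < `|u - t| < e -> lienard_at (fun u => g u 0 0) (fun u => g u 0 1) u.
  have [ut|ut|->] := ltgtP u t; last by rewrite subrr normr0 ltxx.
    by rewrite ltr0_norm ?subr_lt0// => ?; apply: lh; lra.
  by rewrite gtr0_norm ?subr_gt0// => ?; apply: rh; lra.
split.
- apply: (@deriv_limit R (fun u => g u 0 0) (fun u => g u 0 1 - a * g u 0 0 ^+ 2) t e e0 cx).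
    by move=> u /h [].
  apply: cvgB; first exact: cyt.
  by apply: cvgM; [exact: cvg_cst|apply: cvgM; exact: cxt].
- apply: (@deriv_limit R (fun u => g u 0 1) (fun u => - force (g u 0 0)) t e e0 cy).
    by move=> u /h [].
  apply: cvgN; apply: (@continuous_comp _ _ _ (fun u => g u 0 0) force); first exact: cxt.
  exact: force_continuous.
Qed.

(** Conversely, a solution that avoids the origin is a concatenation of arcs: it
    crosses the switching line with x' = y different from 0. *)
Lemma lienard_solution (x y : R -> R) :
  (forall t, lienard_at x y t) -> (forall t, x t != 0 \/ y t != 0) ->
  solution Fp Fm setT (fun t => vec (x t) (y t)).
Proof.
move=> h nz; set g := fun t => _.
have [cx cy] := planar_at_continuous h.
have gc : continuous g.
  move=> t; apply/differentiable_continuous/derivable1_diffP.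
  have [dx dy] := h t.
  have : is_derive t 1 g (vec (y t - a * x t ^+ 2) (- force (x t))).
    apply/is_derive_planeP; rewrite vec0E vec1E /g; split.
      by under eq_fun do rewrite vec0E.
    by under eq_fun do rewrite vec1E.
  by case.
have arcp s t : (forall u, s < u < t -> 0 <= x u) -> system_arc Fp Fm s t g.
  move=> xp; left; split; first exact: continuous_subspaceT.
  move=> u /xp xu; split=> /=; first by rewrite vec0E.
  have [dx dy] := h u; rewrite lienardE vec0E vec1E.
  apply/is_derive_planeP; rewrite vec0E vec1E -(force_pos _ _ b2m b3m xu) /g; split.
    by under eq_fun do rewrite vec0E.
  by under eq_fun do rewrite vec1E.
have arcm s t : (forall u, s < u < t -> x u < 0) -> system_arc Fp Fm s t g.
  move=> xp; right; split; first exact: continuous_subspaceT.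
  move=> u /xp xu; split=> /=; first by rewrite vec0E.
  have [dx dy] := h u; rewrite lienardE vec0E vec1E.
  apply/is_derive_planeP; rewrite vec0E vec1E -(force_neg b2p b3p _ _ (ltW xu)) /g; split.
    by under eq_fun do rewrite vec0E.
  by under eq_fun do rewrite vec1E.
split; first by split; [exact: openT|by move=> ? ? ? ? ? ?|by exists 0].
move=> t _.
have nearx (P : R -> Prop) : (\forall u \near t, P (x u)) ->
    exists2 e, 0 < e & forall u, t - e < u < t + e -> P (x u).
  move=> [/= e e0 eP]; exists e => // u ut; apply: eP => /=.
  by rewrite distrC ltr_norml; lra.
have [xt|xt|xt0] := ltgtP (x t) 0.
- have [e e0 eP] : exists2 e, 0 < e & forall u, t - e < u < t + e -> x u < 0.
    by apply: (nearx (fun v => v < 0)); exact: (cvgr_lt _ (cx t)).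
  by exists e => //; split; apply: arcm => u ut; apply: eP; lra.
- have [e e0 eP] : exists2 e, 0 < e & forall u, t - e < u < t + e -> 0 < x u.
    by apply: (nearx (fun v => 0 < v)); exact: (cvgr_gt _ (cx t)).
  by exists e => //; split; apply: arcp => u ut; apply/ltW/eP; lra.
have [dx dy] := h t; rewrite xt0 expr0n mulr0 subr0 in dx.
have yt : y t != 0 by case: (nz t) => //; rewrite xt0 eqxx.
have [yt0|yt0|yt0] := ltgtP (y t) 0; last by rewrite yt0 eqxx in yt.
- have dNx : is_derive t 1 (fun s => - x s) (- y t) by exact: derive_oppf.
  have [|e e0 eP] := derive_pos_local dNx; first by rewrite oppr_gt0.
  exists e => //; split.
    apply: arcp => u ut; have /eP : 0 < t - u < e by lra.
    by rewrite (_ : t - (t - u) = u); [lra|ring].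
  apply: arcm => u ut; have /eP : 0 < u - t < e by lra.
  by rewrite (_ : t + (u - t) = u); [lra|ring].
- have [e e0 eP] := derive_pos_local dx yt0.
  exists e => //; split.
    apply: arcm => u ut; have /eP : 0 < t - u < e by lra.
    by rewrite (_ : t - (t - u) = u); [lra|ring].
  apply: arcp => u ut; have /eP : 0 < u - t < e by lra.
  by rewrite (_ : t + (u - t) = u); [lra|ring].
Qed.

End SwitchingSolutions.

Section Orbits.
Context {R : realType}.
Variables (a b2p b3p b2m b3m : R).
Hypotheses (b2p_ge0 : 0 <= b2p) (b2m_le0 : b2m <= 0).
Hypotheses (ab3p : a ^+ 2 / 2 < b3p) (ab3m : a ^+ 2 / 2 < b3m).
Hypothesis closing : a = 0 \/ b2m = - b2p /\ b3m = b3p.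
Notation force := (force b2p b3p b2m b3m).
Notation lienard_at := (lienard_at a b2p b3p b2m b3m).
Notation closed_solution := (closed_solution a b2p b3p b2m b3m).
Notation Fp := (lienard a 0 b2p b3p).
Notation Fm := (lienard a 0 b2m b3m).

Lemma lienard_at0 t : lienard_at (fun=> 0) (fun=> 0) t.
Proof.
split; rewrite ?(force_pos _ _ _ _ (lexx 0)) !expr0n/= !mulr0 ?subr0 ?addr0 ?oppr0;
  exact: derive_cstf.
Qed.

Lemma interval_segment (I : set R) s t : is_interval I -> I s -> I t ->
  forall u, Num.min s t <= u <= Num.max s t -> I u.
Proof.
move=> Ii Is It u; case: (leP s t) => _; first exact: Ii.
by apply: Ii.
Qed.

Lemma lienard_interval_unique (I : set R) (x1 y1 x2 y2 : R -> R) c :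
  is_interval I -> I c -> x1 c = x2 c -> y1 c = y2 c ->
  (forall t, I t -> lienard_at x1 y1 t) -> (forall t, I t -> lienard_at x2 y2 t) ->
  forall t, I t -> x1 t = x2 t /\ y1 t = y2 t.
Proof.
move=> Ii Ic xc yc h1 h2 t It.
have Iu := interval_segment Ii Ic It.
have cb : Num.min c t <= c <= Num.max c t by rewrite ge_min le_max lexx.
have tb : Num.min c t <= t <= Num.max c t by rewrite ge_min le_max lexx !orbT.
exact: (lienard_unique cb xc yc (fun u ub => h1 u (Iu u ub))
  (fun u ub => h2 u (Iu u ub)) tb).
Qed.

Lemma solution_eq0 (I : set R) (g : R -> plane R) c : solution Fp Fm I g ->
  I c -> g c = 0 -> forall t, I t -> g t = 0.
Proof.
move=> sol Ic gc t It; have [[_ Ii _] _] := sol.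
have c0 : g c 0 0 = 0 by rewrite gc mxE.
have c1 : g c 0 1 = 0 by rewrite gc mxE.
have [g0 g1] := lienard_interval_unique (x2 := fun=> 0) (y2 := fun=> 0) Ii Ic
  c0 c1 (solution_lienard sol) (fun t _ => lienard_at0 t) It.
by apply: plane_eq; rewrite mxE.
Qed.

Section ClosedOrbit.
Variables (y0 S T : R) (x y : R -> R).
Hypothesis cs : closed_solution y0 S T x y.

Lemma closed_solution_neq0 t : x t != 0 \/ y t != 0.
Proof.
have [[y00 _ _ _ yE] _ h _ _] := cs.
have [xt|] := eqVneq (x t) 0; last by left.
have [yt|] := eqVneq (y t) 0; last by right.
have [_] := @lienard_interval_unique setT x y (fun=> 0) (fun=> 0) t
  (fun _ _ _ _ _ _ => I) I xt yt (fun t _ => h t) (fun t _ => lienard_at0 t) 0 I.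
by rewrite yE => e; move: y00; rewrite e ltxx.
Qed.

Lemma closed_solution_solution :
  solution Fp Fm setT (fun t => vec (x t) (y t)).
Proof.
have [_ _ h _ _] := cs.
by apply: lienard_solution => //; exact: closed_solution_neq0.
Qed.

Lemma closed_solution_periodic :
  periodic_orbit Fp Fm (range (fun t => vec (x t) (y t))).
Proof.
have [[y00 S0 T0 _ yE] [_ yT _ _] _ px py] := cs.
exists (fun t => vec (x t) (y t)), (S + T); split => //.
- exact: closed_solution_solution.
- exact: addr_gt0.
- by move=> t; rewrite px py.
- exists T; apply/eqP => /(congr1 (fun p : plane R => p 0 1)).
  by rewrite !vec1E yE => e; move: yT; rewrite e; lra.
Qed.

End ClosedOrbit.

Lemma nonzero_coord (p : plane R) : p != 0 -> p 0 0 != 0 \/ p 0 1 != 0.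
Proof.
move=> p0; have [e0|] := eqVneq (p 0 0) 0; last by left.
right; apply: contra p0 => /eqP e1.
by apply/eqP/plane_eq; rewrite mxE.
Qed.

(** By uniqueness a maximal solution is a time shift of a closed solution. *)
Lemma orbit_closed (O : set (plane R)) : Defs.orbit Fp Fm O -> O <> [set 0] ->
  exists y0 S T x y, closed_solution y0 S T x y /\
    O = range (fun t => vec (x t) (y t)).
Proof.
move=> [I [g [[sol gmax] ->]]] nz.
have [[_ Ii [c Ic]] _] := sol.
have gc : g c != 0.
  apply/eqP => gc; apply: nz; apply/seteqP; split=> [_ [t It <-]|_ ->] /=.
    exact: solution_eq0 gc _ It.
  by exists c.
have [v [S [T [x [y [t [cs [xt yt]]]]]]]] := closed_solution_through b2p_ge0
  b2m_le0 ab3p ab3m closing (nonzero_coord gc).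
exists v, S, T, x, y; split => //.
have [_ _ h _ _] := cs.
pose x' s := x (s + (t - c)); pose y' s := y (s + (t - c)).
have h' s : lienard_at x' y' s by exact: (planar_at_shift (h (s + (t - c)))).
have sol' : solution Fp Fm setT (fun s => vec (x' s) (y' s)).
  by apply: lienard_solution => // s; rewrite /x' /y'; exact: (closed_solution_neq0 cs).
have ct : c + (t - c) = t by rewrite addrC subrK.
have eqI s : I s -> vec (x' s) (y' s) = g s.
  have xc : x' c = g c 0 0 by rewrite /x' ct xt.
  have yc : y' c = g c 0 1 by rewrite /y' ct yt.
  move=> Is; have [e0 e1] := lienard_interval_unique Ii Ic xc yc
    (fun s _ => h' s) (solution_lienard sol) Is.
  by apply: plane_eq; rewrite ?vec0E ?vec1E.
have IT : setT = I.
  apply: (gmax _ _ sol') => // s; rewrite inE; exact: eqI.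
apply/seteqP; split=> [_ [s Is <-]|_ [s _ <-]].
  by exists (s + (t - c)) => //; exact: eqI.
exists (s - (t - c)); first by rewrite -IT.
by rewrite -eqI -?IT// /x' /y' subrK.
Qed.

Lemma periodic_orbits_cover :
  \bigcup_(O in periodic_orbit Fp Fm) O = ~` [set 0].
Proof.
apply/seteqP; split=> [p [B [g [T [sol _ _ [t gt] ->]]] [s _ <-]] /= gs0|p /= p0].
  have g0 u : g u = 0 by exact: solution_eq0 sol _ gs0 _ _.
  by move: gt; rewrite !g0 eqxx.
have p0' : p != 0 by apply/eqP.
have [v [S [T [x [y [t [cs [xt yt]]]]]]]] := closed_solution_through b2p_ge0
  b2m_le0 ab3p ab3m closing (nonzero_coord p0').
exists (range (fun t => vec (x t) (y t))); first exact: closed_solution_periodic cs.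
by exists t => //; apply: plane_eq; rewrite ?vec0E ?vec1E.
Qed.

End Orbits.

(** * Closed orbits surround the origin *)

Section Surrounding.
Context {R : realType}.

Lemma plane_norm_le (p : plane R) M : 0 <= M -> `|p 0 0| <= M -> `|p 0 1| <= M ->
  `|p| <= M.
Proof.
move=> M0 p0 p1; rewrite /Num.Def.normr/= mx_normrE (bigmax_le _ M0)//= => -[i j] _ /=.
by rewrite ord1; have [->|->] := ord2_cases j.
Qed.

(** An arc along which y decreases is the graph of x as a function of y; xi is
    extended to the whole line by constants. *)
Lemma decreasing_arc_graph (x y : R -> R) (T : R) : 0 < T ->
  continuous x -> continuous y ->
  (forall s t, 0 <= s -> s < t -> t <= T -> y t < y s) ->
  x 0 = 0 -> x T = 0 -> (forall t, 0 < t < T -> 0 < x t) ->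
  exists xi : R -> R, [/\ continuous xi, xi (y 0) = 0, xi (y T) = 0,
    forall v, y T < v < y 0 -> 0 < xi v &
    forall v, y T <= v <= y 0 -> exists2 t, 0 <= t <= T & x t = xi v /\ y t = v].
Proof.
move=> T0 cx cy ydec x0 xT xpos.
have yT0 : y T < y 0 by exact: ydec.
have /choice[g gP] : forall v, exists t, y T <= v <= y 0 -> 0 <= t <= T /\ y t = v.
  move=> v; have [vy|nvy] := boolP (y T <= v <= y 0); last by exists 0.
  by have [t tT yt] := ivt_decr cy (ltW T0) vy; exists t.
have yinj s t : 0 <= s <= T -> 0 <= t <= T -> y s = y t -> s = t.
  move=> /andP[s0 sT] /andP[t0 tT] e; have [st|ts|//] := ltgtP s t.
    by have := ydec _ _ s0 st tT; rewrite e ltxx.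
  by have := ydec _ _ t0 ts sT; rewrite e ltxx.
have ybd t : 0 <= t <= T -> y T <= y t <= y 0.
  move=> /andP[t0 tT]; apply/andP; split.
    by move: tT; rewrite le_eqVlt => /predU1P[->//|tT]; apply/ltW/ydec.
  by move: t0; rewrite le_eqVlt => /predU1P[<-//|t0]; apply/ltW/ydec.
have gK t : 0 <= t <= T -> g (y t) = t.
  by move=> tT; have [gb yg] := gP _ (ybd t tT); exact: yinj.
have cg : {within `[y T, y 0], continuous g}.
  apply: segment_can_ge_continuous; first exact: ltW.
    exact: continuous_subspaceT.
  by move=> t; rewrite in_itv/=; exact: gK.
pose cl v := Num.max (y T) (Num.min v (y 0)).
have clb v : y T <= cl v <= y 0.
  by rewrite le_max lexx ge_max ge_min lexx orbT andbT/= ltW.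
have cl_id v : y T <= v <= y 0 -> cl v = v.
  by move=> /andP[v1 v2]; rewrite /cl (min_idPl v2) (max_idPr v1).
have cgl : continuous (g \o cl).
  move=> v; have clv : (`[y T, y 0]%classic : set R) (cl v) by rewrite /= in_itv/= clb.
  move/subspace_continuousP : cg => /(_ _ clv) cgv U Uv.
  have [/= e e0 eP] := cgv U Uv.
  exists e => //= w vw; apply: eP; last by rewrite /= in_itv/= clb.
  rewrite /=; apply: le_lt_trans vw.
  exact: le_trans (max_lip _ _ _) (min_lip _ _ _).
exists (x \o (g \o cl)); split.
- by move=> v; apply: continuous_comp; [exact: cgl|exact: cx].
- by rewrite /= cl_id ?lexx ?(ltW yT0)// gK// lexx ltW.
- by rewrite /= cl_id ?lexx ?(ltW yT0)// gK// lexx ltW.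
- move=> v /andP[v1 v2]; have vb : y T <= v <= y 0 by rewrite !ltW.
  rewrite /= (cl_id _ vb); have [/andP[g0 gT] yg] := gP v vb; apply: xpos.
  rewrite !lt_neqAle g0 gT !andbT; apply/andP; split; apply/eqP => e.
    by move: v2; rewrite -yg -e ltxx.
  by move: v1; rewrite -yg e ltxx.
- move=> v vb; have [gb yg] := gP v vb.
  by exists (g v) => //; rewrite /= (cl_id _ vb).
Qed.

(** B contains the graphs of xi and - eta over [c, d], which bound a domain
    around the origin.  A connected set that avoids B and contains the origin
    stays inside this domain. *)
Lemma surrounds_between_graphs (xi eta : R -> R) (c d : R) (B : set (plane R)) :
  continuous xi -> continuous eta -> c < 0 < d ->
  xi c = 0 -> xi d = 0 -> eta c = 0 -> eta d = 0 -> 0 < xi 0 -> 0 < eta 0 ->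
  (forall v, c <= v <= d -> B (vec (xi v) v) /\ B (vec (- eta v) v)) ->
  ~ B 0 -> surrounds B 0.
Proof.
move=> cxi ceta /andP[c0 d0] xic xid etac etad xi0 eta0 BP B0; split => //.
(* Phi < 0 inside the domain, and Phi vanishes only on the two graphs *)
pose Phi (p : plane R) : R :=
  Num.max (Num.max (p 0 0 - xi (p 0 1)) (- eta (p 0 1) - p 0 0))
          (Num.max (p 0 1 - d) (c - p 0 1)).
have cp (i : 'I_2) : continuous (fun p : plane R => p 0 i) by exact: coord_continuous.
have cPhi : continuous Phi.
  move=> p.
  have cp0 := cp 0 p; have cp1 := cp 1 p.
  have cx1 : {for p, continuous (fun p : plane R => xi (p 0 1))}.
    by apply: (continuous_comp cp1); exact: cxi.
  have ce1 : {for p, continuous (fun p : plane R => eta (p 0 1))}.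
    by apply: (continuous_comp cp1); exact: ceta.
  apply: (@continuous_max R (plane R)); apply: (@continuous_max R (plane R)).
  - exact: (cvgB cp0 cx1).
  - exact: (cvgB (cvgN ce1) cp0).
  - exact: (cvgB cp1 (cvg_cst d)).
  - exact: (cvgB (cvg_cst c) cp1).
have Phi0B p : Phi p = 0 -> B p.
  move=> e; have : Phi p <= 0 by rewrite e.
  rewrite !ge_max => /andP[/andP[h1 h2] /andP[h3 h4]].
  have vb : c <= p 0 1 <= d by lra.
  have [B1 B2] := BP _ vb.
  have pE u : p 0 0 = u -> vec u (p 0 1) = p.
    by move=> <-; apply: plane_eq; rewrite ?vec0E ?vec1E.
  have : 0 <= Phi p by rewrite e.
  rewrite !le_max => /orP[/orP[]|/orP[]] h.
  - by rewrite -(pE (xi (p 0 1))) //; lra.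
  - by rewrite -(pE (- eta (p 0 1))) //; lra.
  - have e1 : p 0 1 = d by lra.
    by rewrite -(pE (xi (p 0 1))) // e1 xid; rewrite e1 xid etad in h1 h2; lra.
  - have e1 : p 0 1 = c by lra.
    by rewrite -(pE (xi (p 0 1))) // e1 xic; rewrite e1 xic etac in h1 h2; lra.
set C := connected_component _ _.
have CB : C `<=` ~` B by exact: connected_component_sub.
have C0 : C 0 by exact: connected_component_refl.
have PhiC p : C p -> Phi p < 0.
  move=> Cp; rewrite ltNge; apply/negP => Phip.
  have /connected_intervalP ivl : connected (Phi @` C).
    apply: connected_continuous_connected; first exact: component_connected.
    exact: continuous_subspaceT.
  have Phi0 : Phi 0 <= 0.
    by rewrite /Phi !mxE !ge_max; apply/andP; split; apply/andP; split; lra.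
  have [q Cq q0] : (Phi @` C) 0.
    by apply: (ivl (Phi 0) (Phi p)); [exists 0|exists p|rewrite Phi0].
  exact: CB Cq (Phi0B _ q0).
have bounded (f : R -> R) : continuous f -> exists2 M, 0 <= M &
    forall v, c <= v <= d -> f v <= M.
  move=> cf; have cd : c <= d by lra.
  have [m _ mP] := EVT_max cd (continuous_subspaceT cf).
  exists `|f m| => // v vb; apply: le_trans (ler_norm _); apply: mP.
  by rewrite in_itv.
have [M1 M10 M1P] := bounded _ cxi; have [M2 M20 M2P] := bounded _ ceta.
exists (M1 + M2 + d - c); split; first exact: num_real.
move=> M ltM p /PhiC; rewrite !gt_max => /andP[/andP[h1 h2] /andP[h3 h4]].
have vb : c <= p 0 1 <= d by lra.
have m1 := M1P _ vb; have m2 := M2P _ vb.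
by apply: plane_norm_le; rewrite ?ler_norml; lra.
Qed.

Variables (a b2p b3p b2m b3m : R).
Hypotheses (b2p_ge0 : 0 <= b2p) (b2m_le0 : b2m <= 0).
Hypotheses (b3p_gt0 : 0 < b3p) (b3m_gt0 : 0 < b3m).

Lemma closed_solution_surrounds y0 S T x y :
  closed_solution a b2p b3p b2m b3m y0 S T x y ->
  surrounds (range (fun t => vec (x t) (y t))) 0.
Proof.
move=> cs; have [[y00 S0 T0 xE yE] [xT yT xpos xneg] h px py] := cs.
have [cx cy] := planar_at_continuous h.
have xS : x (- S) = 0 by rewrite -px addrA addNr add0r.
have yS : y (- S) = y T by rewrite -py addrA addNr add0r.
have dec1 s t : 0 <= s -> s < t -> t <= T -> y t < y s.
  move=> s0 st tT; have := @mvt_lt R y (fun u => - force b2p b3p b2m b3m (x u)) 0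
    s t st (continuous_subspaceT cy) (fun u _ => (h u).2).
  rewrite mul0r subr_lt0; apply=> u us.
  have xu : 0 < x u by apply: xpos; lra.
  rewrite oppr_lt0 (force_pos _ _ _ _ (ltW xu)) ltr_wpDl//.
    by rewrite mulr_ge0 ?sqr_ge0.
  by rewrite mulr_gt0 ?exprn_gt0.
have dec2 s t : 0 <= s -> s < t -> t <= S -> y (- t) < y (- s).
  move=> s0 st tS; have ts : - t < - s by rewrite ltrN2.
  have := @mvt_gt R y (fun u => - force b2p b3p b2m b3m (x u)) 0
    (- t) (- s) ts (continuous_subspaceT cy) (fun u _ => (h u).2).
  rewrite mul0r subr_gt0; apply=> u us.
  have xu : x u < 0 by apply: xneg; lra.
  rewrite oppr_gt0 (force_neg _ _ _ _ (ltW xu)) ltr_wnDl//.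
    by rewrite mulr_le0_ge0 ?sqr_ge0.
  by rewrite pmulr_rlt0// exprSr pmulr_rlt0// exprn_even_gt0//= lt_eqF.
have [xi [cxi xi0 xiT xip xig]] := decreasing_arc_graph T0 cx cy dec1 xE xT xpos.
have cx' : continuous (fun t => - x (- t)).
  by move=> t; apply: cvgN; exact: (continuous_opp_arg cx).
have cy' := continuous_opp_arg cy.
have xE' : - x (- 0) = 0 by rewrite oppr0 xE oppr0.
have xS' : - x (- S) = 0 by rewrite xS oppr0.
have xpos' t : 0 < t < S -> 0 < - x (- t).
  by move=> tS; rewrite oppr_gt0; apply: xneg; lra.
have [eta [ceta eta0 etaS etap etag]] := @decreasing_arc_graph (fun t => - x (- t))
  (fun t => y (- t)) S S0 cx' cy' dec2 xE' xS' xpos'.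
rewrite oppr0 yE in eta0 etap etag; rewrite yE in xi0 xip xig.
rewrite yS in etaS etap etag.
apply: (surrounds_between_graphs cxi ceta (_ : y T < 0 < y0) xiT xi0 etaS eta0).
- by rewrite yT.
- by apply: xip; rewrite yT.
- by apply: etap; rewrite yT.
- move=> v vb; split.
    by have [t _ [<- <-]] := xig v vb; exists t.
  by have [t _ [<- <-]] := etag v vb; exists (- t) => //; rewrite opprK.
- move=> [t _ e]; have [xt|yt] := closed_solution_neq0 cs t.
    by move: xt; rewrite -(vec0E (x t) (y t)) e mxE eqxx.
  by move: yt; rewrite -(vec1E (x t) (y t)) e mxE eqxx.
Qed.

End Surrounding.

(** * The singular point at the origin *)

Section Nilpotent.
Context {R : realType}.

Lemma switching_field_neq0 (a b2p b3p b2m b3m : R) (p : plane R) :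
  0 <= b2p -> b2m <= 0 -> 0 < b3p -> 0 < b3m -> p != 0 ->
  switching_field (lienard a 0 b2p b3p) (lienard a 0 b2m b3m) p != 0.
Proof.
move=> b2p0 b2m0 b3p0 b3m0; apply: contraNneq => Fp0; apply/eqP.
have [x0 y0] : p 0 0 = 0 /\ p 0 1 = 0; last by apply: plane_eq; rewrite mxE.
move: Fp0; rewrite /switching_field; case: ifPn => xp;
  rewrite lienardE => Fp0;
  have e0 := congr1 (fun q : plane R => q 0 0) Fp0;
  have e1 := congr1 (fun q : plane R => q 0 1) Fp0;
  rewrite /= ?vec0E ?vec1E ?mxE in e0 e1.
- have x0 : p 0 0 = 0.
    apply/eqP; move: xp; rewrite le_eqVlt => /predU1P[<-//|xp]; exfalso.
    have : 0 < b2p * p 0 0 ^+ 2 + b3p * p 0 0 ^+ 3.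
      apply: ltr_wpDl; first by rewrite mulr_ge0 ?sqr_ge0.
      by rewrite mulr_gt0 ?exprn_gt0.
    lra.
  by split=> //; move: e0; rewrite x0 expr0n mulr0 subr0.
- exfalso; rewrite -ltNge in xp.
  have : b2m * p 0 0 ^+ 2 + b3m * p 0 0 ^+ 3 < 0.
    apply: ltr_wnDl; first by rewrite mulr_le0_ge0 ?sqr_ge0.
    by rewrite pmulr_rlt0// exprSr pmulr_rlt0// exprn_even_gt0//= lt_eqF.
  lra.
Qed.

Lemma lienard_0 (a2 a3 b2 b3 : R) : lienard a2 a3 b2 b3 0 = 0.
Proof.
by apply: plane_eq; rewrite !mxE /= ?mxE !expr0n/= !mulr0 ?subr0 ?addr0 ?subr0 ?oppr0.
Qed.

Lemma coord_derive (i : 'I_2) (p v : plane R) :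
  is_derive p v (fun q : plane R => q 0 i) (v 0 i).
Proof.
have cv : h^-1 *: ((h *: v + p) 0 i - p 0 i) @[h --> (0:R)^'] --> v 0 i.
  apply: cvg_near_cst; exists 1 => //= h _ h0.
  by rewrite !mxE addrK /GRing.scale/= mulrA mulVf// mul1r.
by split; [apply/cvg_ex; exists (v 0 i)|exact/cvg_lim].
Qed.

Lemma lienard_differentiable (a2 a3 b2 b3 : R) (p : plane R) :
  differentiable (lienard a2 a3 b2 b3) p.
Proof.
have dc (i : 'I_2) q : differentiable (fun q : plane R => q 0 i) q.
  exact: differentiable_coord.
have dX n : differentiable (fun q : plane R => q 0 0 ^+ n.+1) p.
  by have := differentiableX n (dc 0 p); rewrite exprfctE.
have -> : lienard a2 a3 b2 b3 =
    (fun q : plane R => (q 0 1 - (a2 * q 0 0 ^+ 2 + a3 * q 0 0 ^+ 3)) *: vec 1 0) +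
    (fun q : plane R => (- (b2 * q 0 0 ^+ 2 + b3 * q 0 0 ^+ 3)) *: vec 0 1).
  apply/funext => q; apply: plane_eq;
  by rewrite !mxE /= ?mulr1 ?mulr0 ?addr0 ?add0r.
apply: differentiableD; apply: differentiableZl.
  apply: differentiableB => //.
  by apply: differentiableD; apply: differentiableM.
apply: differentiableN.
by apply: differentiableD; apply: differentiableM.
Qed.

Lemma jacobian_lienard0 (a2 a3 b2 b3 : R) (i j : 'I_2) :
  jacobian (lienard a2 a3 b2 b3) 0 i j = ((i == 1) && (j == 0))%:R.
Proof.
have dF := lienard_differentiable a2 a3 b2 b3 0.
rewrite /jacobian mxE -deriveE//.
set v : plane R := delta_mx 0 i.
have -> : 'D_v (lienard a2 a3 b2 b3) 0 = vec (v 0 1) 0.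
  rewrite derive_mx; last exact: diff_derivable.
  have z : (0 : plane R) 0 0 = 0 by rewrite mxE.
  have c0 := coord_derive 0 (0 : plane R) v; have c1 := coord_derive 1 (0 : plane R) v.
  apply: plane_eq; rewrite mxE ?vec0E ?vec1E.
    have -> : (fun t : plane R => lienard a2 a3 b2 b3 t 0 0) =
      (fun q : plane R => q 0 1) - (a2 \*: (fun q : plane R => q 0 0) ^+ 2 +
        a3 \*: (fun q : plane R => q 0 0) ^+ 3).
      by apply/funext => q; rewrite mxE !exprfctE.
    by rewrite derive_val /= z expr1 expr0n /= !mulr0 !scale0r !scaler0 addr0 subr0.
  have -> : (fun t : plane R => lienard a2 a3 b2 b3 t 0 1) =
    - (b2 \*: (fun q : plane R => q 0 0) ^+ 2 + b3 \*: (fun q : plane R => q 0 0) ^+ 3).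
    by apply/funext => q; rewrite mxE !exprfctE.
  by rewrite derive_val /= z expr1 expr0n /= !mulr0 !scale0r !scaler0 addr0 oppr0.
rewrite mxE /v mxE; have [->|->] := ord2_cases j; have [->|->] := ord2_cases i => //=.
Qed.

Lemma lienard_nilpotent (a2 a3 b2 b3 : R) :
  nilpotent_nonzero (jacobian (lienard a2 a3 b2 b3) 0).
Proof.
set J := jacobian _ _.
have JE i j : J i j = ((i == 1) && (j == 0))%:R by exact: jacobian_lienard0.
split; last first.
  apply/eqP => /matrixP/(_ 1 0); rewrite JE mxE /= => /eqP; by rewrite oner_eq0.
set A := map_mx _ _.
have AE i j : A i j = ((i == 1) && (j == 0))%:R by rewrite mxE JE rmorph_nat.
move=> l /=; apply/eigenvalueP/eqP => [[v vA v0]|->].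
  have e j : \sum_k v 0 k * A k j = l * v 0 j.
    by have /rowP/(_ j) := vA; rewrite !mxE.
  have sum2 (f : 'I_2 -> R[i]) : \sum_k f k = f 0 + f 1.
    by rewrite big_ord_recl big_ord1; congr (f _ + f _); exact: val_inj.
  have e1 := e 1; have e0 := e 0.
  rewrite !sum2 !AE /= !mulr0 add0r in e1; rewrite !sum2 !AE /= mulr0 add0r mulr1 in e0.
  apply: contraNeq v0 => l0; apply/eqP/rowP => j; rewrite mxE.
  have v1 : v 0 1 = 0.
    by move/esym/eqP : e1; rewrite mulf_eq0 (negbTE l0) => /eqP.
  have [->|->//] := ord2_cases j.
  by move/esym/eqP : e0; rewrite v1 mulf_eq0 (negbTE l0) => /eqP.
exists (delta_mx 0 0).
  apply/rowP => j; rewrite scale0r mxE [RHS]mxE big1// => k _.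
  by rewrite AE mxE eqxx /=; have [->|->] := ord2_cases k; rewrite ?mul0r ?mulr0.
by apply/eqP => /matrixP/(_ 0 0); rewrite !mxE !eqxx /= => /eqP; rewrite oner_eq0.
Qed.

End Nilpotent.

Theorem theorem1p2 (R : realType)
    (a2p a3p b2p b3p a2m a3m b2m b3m : R)
    (hb2p : 0 <= b2p) (hb2m : b2m <= 0)
    (hG : [/\ a2p = 0 /\ a2m = 0, a3p = 0 /\ a3m = 0, 0 < b3p & 0 < b3m] \/
          [/\ a2m = a2p, a3p = 0 /\ a3m = 0, b2m = - b2p, b3m = b3p
            & a2p ^+ 2 / 2 < b3p]) :
  nilpotent_global_center (lienard a2p a3p b2p b3p) (lienard a2m a3m b2m b3m) 0.
Proof.
have [[-> -> ->] hp hm closing] : [/\ [/\ a2m = a2p, a3p = 0 & a3m = 0],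
    a2p ^+ 2 / 2 < b3p, a2p ^+ 2 / 2 < b3m & a2p = 0 \/ b2m = - b2p /\ b3m = b3p].
  case: hG => [[[-> ->] [-> ->] hp hm]|[-> [-> ->] -> -> hb]].
    by rewrite expr0n mul0r; split => //; left.
  by split => //; right.
have pos (b : R) : a2p ^+ 2 / 2 < b -> 0 < b.
  by apply: le_lt_trans; rewrite divr_ge0// sqr_ge0.
have b3p0 := pos _ hp; have b3m0 := pos _ hm.
split; last exact: periodic_orbits_cover.
split; first split.
- split.
  + exact: lienard_0.
  + exact: lienard_0.
  + near=> p; apply: switching_field_neq0 => //.
    by near: p; exact: nbhs_dnbhs_neq.
- exact: lienard_nilpotent.
- exact: lienard_nilpotent.
exists setT; first exact: filterT.
move=> B oB _ nB.
have [y0 [S [T [x [y [cs ->]]]]]] := orbit_closed hb2p hb2m hp hm closing oB nB.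
split; first exact: closed_solution_periodic cs.
exact: closed_solution_surrounds hb2p hb2m b3p0 b3m0 _ _ _ _ _ cs.
Unshelve. all: by end_near. Qed.
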